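(* Let $\{\underline{X}_t\}_{t\in\mathbb{Z}}$ be a centred real $p$-dimensional time series whose covariance operator satisfies $0<\lambda_{\inf}\le\lambda_{\sup}<\infty$, and let $D=(D_{a,b})_{1\le a,b\le p}$ be the associated operator built from the projection coefficients. Let $\rho^{(c,d)|-\{a,b\}}_{t,\tau}$ and $\rho^{(a,a)|-\{a\}}_{t,\tau}$ be the time series partial covariances. Then: (i) (Conditional noncorrelation) for $a\neq b$: $D_{a,b}=0$ if and only if $\rho^{(a,b)|-\{a,b\}}_{t,\tau}=0$ for all $t,\tau\in\mathbb{Z}$. (ii) (Conditionally stationary node) $D_{a,a}$ is a Toeplitz operator if and only if $\rho^{(a,a)|-\{a\}}_{t,\tau}=\rho^{(a,a)|-\{a\}}_{0,t-\tau}$ for all $t,\tau\in\mathbb{Z}$. (iii) (Conditionally stationary pair) for $a\neq b$: $D_{a,a}$, $D_{b,b}$ and $D_{a,b}$ are all Toeplitz if and only if for all $t,\tau\in\mathbb{Z}$, $\rho^{(a,a)|-\{a,b\}}_{t,\tau}=\rho^{(a,a)|-\{a,b\}}_{0,t-\tau}$, $\rho^{(b,b)|-\{a,b\}}_{t,\tau}=\rho^{(b,b)|-\{a,b\}}_{0,t-\tau}$ and $\rho^{(a,b)|-\{a,b\}}_{t,\tau}=\rho^{(a,b)|-\{a,b\}}_{0,\tau-t}$.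
   Context: Fix $p\ge1$. $\{\underline{X}_t\}_{t\in\mathbb{Z}}$, $\underline{X}_t=(X_t^{(1)},\dots,X_t^{(p)})'$, is a real-valued time series with mean zero and finite variances on a probability space; ${\bf C}_{t,\tau}=\mathrm{Cov}(\underline{X}_t,\underline{X}_\tau)$ is $p\times p$, with $\sup_t\|{\bf C}_{t,t}\|_\infty<\infty$ ($\|\cdot\|_\infty$ = largest absolute entry). $\ell_2$ is the Hilbert space of square-summable complex sequences indexed by $\mathbb{Z}$, and $\ell_{2,p}$ the Hilbert space of $v=\mathrm{vec}[u^{(1)},\dots,u^{(p)}]$ with $u^{(s)}\in\ell_2$, with inner product the sum of the $\ell_2$ inner products. $C=(C_{a,b})_{1\le a,b\le p}$ is the infinite block matrix with $[C_{a,b}]_{t,\tau}=[{\bf C}_{t,\tau}]_{a,b}$, acting on $\ell_{2,p}$ by matrix multiplication; $\lambda_{\sup}=\sup_{\|v\|_2=1}\langle v,Cv\rangle$ and $\lambda_{\inf}=\inf_{\|v\|_2=1}\langle v,Cv\rangle$ over $v\in\ell_{2,p}$. $\mathcal{H}$ is the closed linear span (in the $L^2$ space with inner product $\mathrm{Cov}$) of all $X_t^{(c)}$, $t\in\mathbb{Z}$, $1\le c\le p$; $P_{\mathcal{M}}$ is the orthogonal projection onto a closed subspace $\mathcal{M}$; $\mathcal{H}-X_t^{(a)}$ is the closed span of all $X_s^{(c)}$ with $(s,c)\ne(t,a)$. When $0<\lambda_{\inf}\le\lambda_{\sup}<\infty$ there are unique coefficients with $P_{\mathcal{H}-X_t^{(a)}}(X_t^{(a)})=\sum_{\tau\in\mathbb{Z}}\sum_{b=1}^p\beta_{(\tau,b)\to(t,a)}X_\tau^{(b)}$,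 $\beta_{(t,a)\to(t,a)}=0$; put $\sigma_{a,t}^2=\mathrm{E}[X_t^{(a)}-P_{\mathcal{H}-X_t^{(a)}}(X_t^{(a)})]^2$. Define $[D_{a,b}]_{t,\tau}=1/\sigma_{a,t}^2$ if $(a,t)=(b,\tau)$, and $[D_{a,b}]_{t,\tau}=-\beta_{(\tau,b)\to(t,a)}/\sigma^2_{a,t}$ otherwise; $D=(D_{a,b})$. For $\mathcal{S}\subseteq\{1,\dots,p\}$ let $\mathcal{H}-(X^{(c)};c\in\mathcal{S})$ be the closed span of all $X_s^{(c)}$ with $s\in\mathbb{Z}$, $c\notin\mathcal{S}$, and $X_t^{(a)|-\mathcal{S}}=X_t^{(a)}-P_{\mathcal{H}-(X^{(c)};c\in\mathcal{S})}(X_t^{(a)})$. The time series partial covariances are $\rho^{(c,d)|-\{a,b\}}_{t,\tau}=\mathrm{Cov}[X_t^{(c)|-\{a,b\}},X_\tau^{(d)|-\{a,b\}}]$ for $c,d\in\{a,b\}$, and $\rho^{(a,a)|-\{a\}}_{t,\tau}=\mathrm{Cov}[X_t^{(a)|-\{a\}},X_\tau^{(a)|-\{a\}}]$. An infinite matrix $A=(A_{t,\tau})_{t,\tau\in\mathbb{Z}}$ is Toeplitz if $A_{t,\tau}=a_{t-\tau}$ for some sequence $(a_r)_{r\in\mathbb{Z}}$. *)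

(* Defs.v *)
From HB Require Import structures.
From mathcomp Require Import all_boot all_order all_algebra.
From mathcomp Require Import complex.
From mathcomp Require Import all_classical all_reals all_analysis.

Set Implicit Arguments.
Unset Strict Implicit.
Unset Printing Implicit Defensive.

Import Order.TTheory GRing.Theory Num.Theory.
Import numFieldNormedType.Exports.

Local Open Scope classical_set_scope.
Local Open Scope ring_scope.
Local Open Scope complex_scope.

Section sequences_on_Z.

(* Sum over [-n, n): Posz k is k and Negz k is - (k + 1). *)
Definition zpartial (V : nmodType) (f : int -> V) (n : nat) : V :=
  \sum_(k < n) (f (Posz k) + f (Negz k)).

Definition zsum (K : numFieldType) (f : int -> K) : K := limn (zpartial f : nat -> K).

Definition ell2 (K : numFieldType) : set (int -> K) :=
  [set u : int -> K | cvgn (zpartial (fun t => `|u t| ^+ 2) : nat -> K)].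

Definition toeplitz (R : Type) (A : int -> int -> R) : Prop :=
  exists r : int -> R, forall t tau, A t tau = r (t - tau).

End sequences_on_Z.

Section l2p.
Context (R : realType) (p : nat).

(* v s is the s-th block u^(s) of vec[u^(1), ..., u^(p)]. *)
Definition ell2p : set ('I_p -> int -> R[i]) :=
  [set v | forall s, @ell2 R[i] (v s)].

Definition dotp (v w : 'I_p -> int -> R[i]) : R[i] :=
  \sum_(s < p) @zsum R[i] (fun t => (v s t)^* * w s t).

(* A a b is the (a, b) block of an infinite block matrix. *)
Definition block_mul (A : 'I_p -> 'I_p -> int -> int -> R)
    (v : 'I_p -> int -> R[i]) : 'I_p -> int -> R[i] :=
  fun a t => \sum_(b < p) @zsum R[i] (fun tau => (A a b t tau)%:C * v b tau).

(* The values <v, A v>, ||v||_2 = 1.  They are used for a real symmetric A,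
   for which <v, A v> is real, so that taking the real part loses nothing.
   For a covariance matrix A the convention made by [lim] for divergent series
   is immaterial when the supremum is finite: a bound on the finitely supported
   unit vectors already makes A bounded on the whole of ell2p, and then all
   the series involved converge absolutely. *)
Definition num_range (A : 'I_p -> 'I_p -> int -> int -> R) : set (\bar R) :=
  [set (complex.Re (dotp v (block_mul A v)))%:E
    | v in [set v | ell2p v /\ dotp v v = 1]].

Definition lambda_sup A : \bar R := ereal_sup (num_range A).
Definition lambda_inf A : \bar R := ereal_inf (num_range A).

End l2p.

Section time_series.
Context (d : measure_display) (T : measurableType d) (R : realType).
Context (P : probability T R) (p : nat).
Implicit Types (X : int -> 'I_p -> {RV P >-> R}) (Y Z : T -> R).

(* The space of centred square-integrable variables, in which Cov is the
   inner product (up to almost sure equality). *)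
Definition centredL2 : set (T -> R) :=
  [set Y | Y \in Lfun P 2%:E /\ ('E_P[Y] = 0)%E].

Definition cov Y Z : R := fine (covariance P Y Z).

Definition linspan X (I : set (int * 'I_p)) : set (T -> R) :=
  [set Y | exists (s : seq (int * 'I_p)) (c : int * 'I_p -> R),
    (forall i, i \in s -> I i) /\
    Y = (fun w => \sum_(i <- s) c i * X i.1 i.2 w)].

Definition closed_linspan X (I : set (int * 'I_p)) : set (T -> R) :=
  [set Y | centredL2 Y /\ forall e : R, 0 < e ->
    exists2 Z, linspan X I Z & cov (Y \- Z) (Y \- Z) < e ^+ 2].

(* [proj] picks one of the almost surely equal versions of the orthogonal
   projection of Y onto M; the default value of [xget] is reached only when
   there is no orthogonal projection, which cannot happen for Y in centredL2
   and M a closed linear span. *)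
Definition is_proj (M : set (T -> R)) Y Z : Prop :=
  M Z /\ forall W, M W -> cov (Y \- Z) W = 0.

Definition proj (M : set (T -> R)) Y : T -> R :=
  xget (cst 0) [set Z | is_proj M Y Z].

Definition Cmx X (t tau : int) : 'M[R]_p :=
  \matrix_(a < p, b < p) cov (X t a) (X tau b).

Definition Cblock X (a b : 'I_p) (t tau : int) : R := Cmx X t tau a b.

Definition node_proj X t a : T -> R :=
  proj (closed_linspan X [set i | i != (t, a)]) (X t a).

(* be tau b stands for the coefficient of X_tau^(b); the series converges
   in mean square. *)
Definition is_coef X t a (be : int -> 'I_p -> R) : Prop :=
  be t a = 0 /\
  (fun n => let S := zpartial (fun tau => fun w : T =>
                      \sum_(b < p) be tau b * X tau b w) n in
            cov (node_proj X t a \- S) (node_proj X t a \- S)) @ \oo --> (0 : R).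

(* beta X tau b t a is beta_{(tau, b) -> (t, a)}.  When
   0 < lambda_inf <= lambda_sup < +oo exactly one family satisfies [is_coef],
   so that [xget] returns it. *)
Definition beta X (tau : int) (b : 'I_p) (t : int) (a : 'I_p) : R :=
  xget (fun _ _ => 0) [set be | is_coef X t a be] tau b.

Definition sigma2 X a t : R :=
  fine ('E_P[(X t a \- node_proj X t a) ^+ 2])%E.

Definition Dblock X (a b : 'I_p) (t tau : int) : R :=
  if (a, t) == (b, tau) then (sigma2 X a t)^-1
  else - beta X tau b t a / sigma2 X a t.

Definition residual X (S : {set 'I_p}) t a : T -> R :=
  X t a \- proj (closed_linspan X [set i | i.2 \notin S]) (X t a).

(* rho X S c e t tau is rho^{(c,e)|-S}_{t,tau}. *)
Definition rho X (S : {set 'I_p}) (c e : 'I_p) (t tau : int) : R :=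
  cov (residual X S t c) (residual X S tau e).

End time_series.

(* Main.v *)
Require Import Defs.
From mathcomp Require Import all_boot all_order all_algebra.
From mathcomp Require Import complex ring lra.
From mathcomp Require Import all_classical all_reals all_analysis.
From mathcomp Require Import measurable_realfun.

Set Implicit Arguments.
Unset Strict Implicit.
Unset Printing Implicit Defensive.

Import Order.TTheory GRing.Theory Num.Theory.
Import numFieldNormedType.Exports.

Local Open Scope classical_set_scope.
Local Open Scope ring_scope.

(** Let H be the closed span of the variables X_t^(a), with the covariance as
    inner product.  The bounds on the numerical range of C make these
    variables a Riesz basis of H.  The dual basis is made of the rescaled
    prediction errors y_(t,a) = (X_t^(a) - P X_t^(a)) / sigma^2_(a,t), where P
    projects onto the closed span of all the other variables.  The
    coefficients of a vector of H in the basis X are its inner products with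
    the y's, so that the coefficients beta of P X_t^(a) are inner products and
    D is the Gram matrix of the dual basis:
    [D_ab]_(t,u) = Cov(y_(t,a), y_(u,b)) ([dual_series]).

    Let S be {a} or {a, b}, let J be the set of the indices (t, c) with c in S,
    and let M be the closed span of the variables outside J.  In the
    orthogonal complement of M in H live both the residuals r_j = X_j - P_M X_j
    and the dual vectors y_j, for j in J.  These two families are biorthogonal,
    and each lies in the closed span of the other ([dual_mem_residuals],
    [residual_mem_duals]).  The Gram matrix of the residuals is the matrix of
    the partial covariances; the block of D indexed by J is thus its inverse.

    No infinite matrix is inverted: each of the three claims says that a Gram
    matrix is invariant under signed permutations of J.  The blocks (a, b) and
    (b, a) vanish exactly when reversing the sign of the component b changes
    nothing, and the blocks are Toeplitz exactly when all the time shifts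
    change nothing.  Such an invariance passes from a family to a biorthogonal
    one contained in its closed span ([gram_invariance]): the signed
    permutation acts isometrically on finite combinations of the first family,
    and it carries approximations of a dual vector to approximations of the
    permuted dual vector.

    Almost surely equal variables are not identified, so the argument is
    carried out for a positive semidefinite form.  Orthogonal projections exist
    because the square-integrable functions are complete ([L2_complete]). *)

(** * Semi-inner product spaces *)

(** Positivity only: a variable that vanishes almost surely has norm 0. *)
Definition semi_inner (R : realType) (E : lmodType R) (ip : E -> E -> R) :=
  [/\ forall x y, ip x y = ip y x,
      forall a x y z, ip (a *: x + y) z = a * ip x z + ip y z
    & forall x, 0 <= ip x x].

Definition ip_cvg (R : realType) (E : lmodType R) (ip : E -> E -> R)
    (u : nat -> E) (l : E) :=
  forall e : R, 0 < e ->
    exists N, forall n, (N <= n)%N -> ip (l - u n) (l - u n) < e.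

Definition ip_complete (R : realType) (E : lmodType R) (ip : E -> E -> R) :=
  forall u : nat -> E,
    (forall e : R, 0 < e -> exists N, forall m n, (N <= m)%N -> (N <= n)%N ->
       ip (u m - u n) (u m - u n) < e) ->
    exists l, ip_cvg ip u l.

Definition subspace (R : realType) (E : lmodType R) (V : set E) :=
  V 0 /\ forall a x y, V x -> V y -> V (a *: x + y).

(** Distances are squared, here and below, which avoids square roots. *)
Definition ip_closure (R : realType) (E : lmodType R) (ip : E -> E -> R) (V : set E) :=
  [set y | forall e : R, 0 < e -> exists2 z, V z & ip (y - z) (y - z) < e].

(** Lists of pairs (coefficient, index) may repeat an index, so that sums of
    combinations are concatenations. *)
Definition lspan (R : realType) (E : lmodType R) (I : eqType) (x : I -> E)
    (J : set I) : set E :=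
  [set y | exists2 s : seq (R * I), (forall p, p \in s -> J p.2)
     & y = \sum_(p <- s) p.1 *: x p.2].

Lemma sum_eq1_seq (V : nmodType) (I : eqType) (s : seq I) j (F : I -> V) :
  uniq s -> j \in s -> \sum_(i <- s | i == j) F i = F j.
Proof.
move=> us js; rewrite big_mkcond (bigD1_seq j)//= eqxx big1 ?addr0// => i.
by move=> /negPf->.
Qed.

Lemma sum_sub_seq (V : nmodType) (I : eqType) (s b : seq I) (F : I -> V) :
  uniq s -> uniq b -> {subset s <= b} ->
  \sum_(i <- s) F i = \sum_(i <- b | i \in s) F i.
Proof.
move=> us ub sb; rewrite -[RHS]big_filter; apply: perm_big.
apply: uniq_perm => //; first exact: filter_uniq.
by move=> i; rewrite mem_filter andb_idr// => /sb.
Qed.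

Section SemiInner.
Context (R : realType) (E : lmodType R) (ip : E -> E -> R).
Context (ipP : semi_inner ip).
Implicit Types (x y z w : E) (V : set E).

Local Notation sqn x := (ip x x).

Lemma ipC x y : ip x y = ip y x.
Proof. by case: ipP. Qed.

Lemma ip_ge0 x : 0 <= sqn x.
Proof. by case: ipP. Qed.

Lemma ipDl x y z : ip (x + y) z = ip x z + ip y z.
Proof. by case: ipP => _ h _; rewrite -[x in LHS]scale1r h mul1r. Qed.

Lemma ip0l z : ip 0 z = 0.
Proof. by have := ipDl 0 0 z; rewrite addr0; lra. Qed.

Lemma ipZl a x z : ip (a *: x) z = a * ip x z.
Proof. by case: ipP => _ h _; rewrite -[a *: x]addr0 h ip0l addr0. Qed.

Lemma ipNl x z : ip (- x) z = - ip x z.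
Proof. by rewrite -scaleN1r ipZl mulN1r. Qed.

Lemma ipBl x y z : ip (x - y) z = ip x z - ip y z.
Proof. by rewrite ipDl ipNl. Qed.

Lemma ipDr x y z : ip z (x + y) = ip z x + ip z y.
Proof. by rewrite ipC ipDl !(ipC z). Qed.

Lemma ip0r z : ip z 0 = 0.
Proof. by rewrite ipC ip0l. Qed.

Lemma ipZr a x z : ip z (a *: x) = a * ip z x.
Proof. by rewrite ipC ipZl ipC. Qed.

Lemma ipBr x y z : ip z (x - y) = ip z x - ip z y.
Proof. by rewrite ipC ipBl !(ipC z). Qed.

Definition ipE := (ipBl, ipBr, ipDl, ipDr, ipZl, ipZr).

Lemma ip_suml (I : Type) (s : seq I) (F : I -> E) z :
  ip (\sum_(i <- s) F i) z = \sum_(i <- s) ip (F i) z.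
Proof.
elim: s => [|i s IHs]; first by rewrite !big_nil ip0l.
by rewrite !big_cons ipDl IHs.
Qed.

Lemma ip_sumr (I : Type) (s : seq I) (F : I -> E) z :
  ip z (\sum_(i <- s) F i) = \sum_(i <- s) ip z (F i).
Proof. by rewrite ipC ip_suml; apply: eq_bigr => i _; rewrite ipC. Qed.

Lemma sqnB x y : sqn (x - y) = sqn x - 2 * ip x y + sqn y.
Proof. by rewrite !ipE (ipC y x); ring. Qed.

Lemma sqnBC x y : sqn (x - y) = sqn (y - x).
Proof. by rewrite !sqnB (ipC y x); ring. Qed.

Lemma sqnD_le x y : sqn (x + y) <= 2 * sqn x + 2 * sqn y.
Proof. by have := ip_ge0 (x - y); rewrite !ipE (ipC y x); lra. Qed.

Lemma cauchy_schwarz x y : ip x y ^+ 2 <= sqn x * sqn y.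
Proof.
have h a : 0 <= a ^+ 2 * sqn x + 2 * a * ip x y + sqn y.
  by have := ip_ge0 (a *: x + y); rewrite !ipE (ipC y x); lra.
have := ip_ge0 x; rewrite le_eqVlt => /predU1P[x0|x0].
  have [->|xy0] := eqVneq (ip x y) 0; first by rewrite -x0 mul0r expr0n.
  have := h (- (sqn y + 1) / (2 * ip x y)); rewrite -x0.
  rewrite (_ : _ + _ + _ = -1); last by field.
  by rewrite lerNr oppr0 ler10.
have := h (- ip x y / sqn x).
rewrite (_ : _ + _ + _ = (sqn x * sqn y - ip x y ^+ 2) / sqn x); last first.
  by field; rewrite gt_eqF.
by rewrite pmulr_lge0 ?invr_gt0// subr_ge0.
Qed.

Lemma subspaceD V x y : subspace V -> V x -> V y -> V (x + y).
Proof. by move=> [_ h] Vx Vy; rewrite -[x]scale1r; apply: h. Qed.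

Lemma subspaceZ V a x : subspace V -> V x -> V (a *: x).
Proof. by move=> [h0 h] Vx; rewrite -[_ *: _]addr0; apply: h. Qed.

Lemma subspaceB V x y : subspace V -> V x -> V y -> V (x - y).
Proof. by move=> [_ h] Vx Vy; rewrite addrC -scaleN1r; apply: h. Qed.

Lemma subspace_sum (I : eqType) V (s : seq I) (c : I -> R) (x : I -> E) :
  subspace V -> (forall i, i \in s -> V (x i)) -> V (\sum_(i <- s) c i *: x i).
Proof.
move=> hV hx; rewrite big_seq; elim/big_ind: _ => [|y z|i /hx].
- by case: hV.
- exact: subspaceD.
- exact: subspaceZ.
Qed.

Lemma lspan_subspace (I : eqType) (x : I -> E) (J : set I) :
  subspace (lspan x J).
Proof.
split; first by exists [::]; rewrite ?big_nil.
move=> a _ _ [s hs ->] [s' hs' ->].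
exists ([seq (a * p.1, p.2) | p <- s] ++ s') => [p|].
  rewrite mem_cat => /orP[/mapP[q qs ->]|]; [exact: hs qs|exact: hs'].
rewrite big_cat/= big_map/= scaler_sumr; congr (_ + _).
by apply: eq_bigr => p _; rewrite scalerA.
Qed.

Lemma mem_lspan (I : eqType) (x : I -> E) (J : set I) i : J i -> lspan x J (x i).
Proof.
move=> Ji; exists [:: (1, i)] => [p|]; first by rewrite inE => /eqP->.
by rewrite big_seq1 scale1r.
Qed.

Lemma lspan_sub (I : eqType) (x : I -> E) (J : set I) V :
  subspace V -> (forall i, J i -> V (x i)) -> lspan x J `<=` V.
Proof.
move=> hV hx _ [s hs ->]; rewrite big_seq; elim/big_ind: _ => [|y z|p /hs].
- by case: hV.
- exact: subspaceD.
- by move=> Jp; apply: subspaceZ => //; apply: hx.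
Qed.

Lemma lspan_uniq (I : eqType) (x : I -> E) (J : set I) y : lspan x J y ->
  exists s (c : I -> R), [/\ uniq s, forall i, i \in s -> J i
    & y = \sum_(i <- s) c i *: x i].
Proof.
move=> [s hs ->]; exists (undup (map snd s)).
exists (fun i => \sum_(p <- s | p.2 == i) p.1); split.
- exact: undup_uniq.
- by move=> i; rewrite mem_undup => /mapP[p /hs Jp ->].
under [RHS]eq_bigr do rewrite scaler_suml big_mkcond.
rewrite exchange_big/= big_seq [RHS]big_seq; apply: eq_bigr => p ps.
rewrite -big_mkcond/=; under eq_bigl do rewrite eq_sym.
by rewrite sum_eq1_seq ?undup_uniq// mem_undup map_f.
Qed.

Lemma sub_ip_closure V : V `<=` ip_closure ip V.
Proof. by move=> x Vx e e0; exists x => //; rewrite subrr ip0l. Qed.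

Lemma ip_closureS V W : V `<=` W -> ip_closure ip V `<=` ip_closure ip W.
Proof.
by move=> VW x + e e0 => /(_ e e0)[z Vz zx]; exists z => //; apply: VW.
Qed.

Lemma ip_closure_idem V : ip_closure ip (ip_closure ip V) `<=` ip_closure ip V.
Proof.
move=> x hx e e0.
have [z hz xz] := hx (e / 4) ltac:(lra).
have [w Vw zw] := hz (e / 4) ltac:(lra).
exists w => //; have := sqnD_le (x - z) (z - w).
by rewrite addrA subrK; lra.
Qed.

Lemma ip_closure_subspace V : subspace V -> subspace (ip_closure ip V).
Proof.
move=> hV; split; first by apply: sub_ip_closure; case: hV.
move=> a x y hx hy e e0.
have c0 : 0 < 4 * (a ^+ 2 + 1) by have := sqr_ge0 a; lra.
have [x' Vx' xx'] := hx (e / (4 * (a ^+ 2 + 1))) (divr_gt0 e0 c0).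
have [y' Vy' yy'] := hy (e / 4) ltac:(lra).
exists (a *: x' + y'); first by case: hV => _; apply.
have -> : a *: x + y - (a *: x' + y') = a *: (x - x') + (y - y').
  by rewrite scalerBr opprD addrACA.
have := sqnD_le (a *: (x - x')) (y - y'); rewrite ipZl ipZr.
move: xx'; rewrite ltr_pdivlMr// => xx'.
by have := ip_ge0 (x - x'); lra.
Qed.

Lemma ip_closure_orth V w : (forall z, V z -> ip w z = 0) ->
  forall z, ip_closure ip V z -> ip w z = 0.
Proof.
move=> hV z hz; apply/eqP; rewrite -(sqrf_eq0 (ip w z)); apply/negPn/negP => h.
have {}h : 0 < ip w z ^+ 2 by rewrite lt_def h sqr_ge0.
have w0 : 0 < sqn w + 1 by have := ip_ge0 w; lra.
have [z' Vz'] := hz _ (divr_gt0 h w0); rewrite ltr_pdivlMr// => zz'.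
have := cauchy_schwarz w (z - z'); rewrite ipBr (hV z')// subr0.
by have := ip_ge0 (z - z'); lra.
Qed.

Lemma eventually_invS_lt (e : R) : 0 < e ->
  exists N, forall n, (N <= n)%N -> n.+1%:R^-1 < e.
Proof.
move=> e0; exists (Num.truncn e^-1) => n Nn.
rewrite invf_plt ?posrE//; apply: lt_le_trans (truncnS_gt _) _.
by rewrite ler_nat.
Qed.

(** The classical argument: by the parallelogram law a minimizing sequence for
    the distance from y to V is a Cauchy sequence. *)
Lemma orth_proj_exists V y : ip_complete ip -> subspace V ->
  exists z, ip_closure ip V z /\ forall w, ip_closure ip V w -> ip (y - z) w = 0.
Proof.
move=> cE hV.
pose D := [set sqn (y - z) | z in V].
have D0 : D (sqn (y - 0)) by exists 0 => //; case: hV.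
have lbD : has_inf D.
  split; first by exists (sqn (y - 0)).
  by exists 0 => _ [z _ <-]; apply: ip_ge0.
pose dm := inf D.
have dm_le z : V z -> dm <= sqn (y - z).
  by move=> Vz; apply: (ge_inf lbD.2); exists z.
have near_inf n : exists z, V z /\ sqn (y - z) < dm + n.+1%:R^-1.
  have n0 : 0 < n.+1%:R^-1 :> R by rewrite invr_gt0.
  by have [_ [z Vz <-] h] := inf_adherent n0 lbD; exists z.
have [u hu] := choice near_inf.
have [z uz] : exists z, ip_cvg ip u z.
  apply: cE => e e0.
  have [N hN] := @eventually_invS_lt (e / 4) ltac:(lra).
  exists N => m n /hN hm /hN hn.
  have [Vm um] := hu m; have [Vn un] := hu n.
  have /dm_le : V (2^-1 *: u m + 2^-1 *: u n).
    by apply: subspaceD => //; apply: subspaceZ.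
  have -> : y - (2^-1 *: u m + 2^-1 *: u n) = 2^-1 *: ((y - u m) + (y - u n)).
    have {1}-> : y = 2^-1 *: y + 2^-1 *: y.
      by rewrite -scalerDl (_ : _ + _ = 1) ?scale1r//; lra.
    by rewrite opprD addrACA -!scalerBr -scalerDr.
  have -> : u m - u n = (y - u n) - (y - u m).
    by rewrite opprB [RHS]addrC subrKA.
  move: (y - u m) (y - u n) um un => p q um un.
  move: hm hn um un; move: (m.+1%:R^-1) (n.+1%:R^-1) => /= r r' hm hn um un.
  by rewrite !ipE (ipC q p); lra.
exists z; split.
  move=> e e0; have [N /(_ N (leqnn N)) hN] := uz e e0.
  by exists (u N) => //; have [] := hu N.
apply: ip_closure_orth => w Vw; apply/eqP.
rewrite -(sqrf_eq0 (ip (y - z) w)); apply/negPn/negP => h.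
have {}h : 0 < ip (y - z) w ^+ 2 by rewrite lt_def h sqr_ge0.
have q0 := ip_ge0 w; have q1 : 0 < 4 * (sqn w + 1) by lra.
have e0 := divr_gt0 h q1.
have [N1 hN1] := eventually_invS_lt e0; have [N2 hN2] := uz _ e0.
pose n := maxn N1 N2; have [Vn un] := hu n.
move: hN1 hN2 => /(_ n (leq_maxl _ _)) hN1 /(_ n (leq_maxr _ _)) hN2.
move: un hN1; move: n.+1%:R^-1 => r un hN1.
(* Moving from u n along w lowers the squared distance from y by about
   a ^+ 2 / sqn w, and at most r can be gained. *)
pose a := ip (y - u n) w.
have an : a ^+ 2 <= r * (sqn w + 1).
  have /dm_le : V (u n + (a / (sqn w + 1)) *: w).
    by apply: subspaceD => //; apply: subspaceZ.
  rewrite opprD addrA sqnB ipZl !ipZr -/a => hdm.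
  have : 0 < r - 2 * (a / (sqn w + 1)) * a
           + (a / (sqn w + 1)) ^+ 2 * sqn w by lra.
  rewrite (_ : _ + _ = (r * (sqn w + 1) ^+ 2 - a ^+ 2 * (sqn w + 2)) /
    (sqn w + 1) ^+ 2); last by field; lra.
  rewrite pmulr_lgt0 ?invr_gt0 ?exprn_gt0//; last lra.
  rewrite subr_gt0 => h1; have h2 := sqr_ge0 a.
  rewrite -(ler_pM2r (_ : 0 < sqn w + 1)); nra.
have := cauchy_schwarz (z - u n) w.
set b := ip (z - u n) w => hb.
have hab : ip (y - z) w = a - b by rewrite /a /b !ipE; ring.
move: hN1 hN2; rewrite !ltr_pdivlMr// hab => hN1 hN2.
have := ip_ge0 (z - u n); have := sqr_ge0 (a + b); nra.
Qed.


Lemma lspan_orth (I : eqType) (x : I -> E) (J : set I) w :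
  (forall i, J i -> ip w (x i) = 0) ->
  forall z, ip_closure ip (lspan x J) z -> ip w z = 0.
Proof.
move=> hw; apply: ip_closure_orth; apply: (@lspan_sub _ x J [set z | ip w z = 0]) => //.
split=> [|a u v /= hu hv]; first exact: ip0r.
by rewrite ipDr ipZr hu hv mulr0 addr0.
Qed.

(** * Gram matrices of biorthogonal families *)

Section GramInvariance.
Context (I : eqType) (J : set I) (x y : I -> E).
Hypothesis xy : forall i j, J i -> J j -> ip (x i) (y j) = (i == j)%:R.
Hypothesis yx : forall i, J i -> ip_closure ip (lspan x J) (y i).

(** The signed permutation f, with signs e, carries a combination z of the x's
    that is close to y i to a combination z' of the same norm.  By
    biorthogonality z and z' have the same inner products with the dual
    vectors, up to signs, whence the exact value of the distance from z' to
    y (f i). *)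
Lemma transport_approx (f g : I -> I) (e : I -> R) i (eps : R) :
  cancel f g -> (forall k, J k -> J (f k)) ->
  (forall k, e k ^+ 2 = 1) ->
  (forall k l, J k -> J l ->
     e k * e l * ip (x (f k)) (x (f l)) = ip (x k) (x l)) ->
  J i -> 0 < eps ->
  exists z z', [/\ sqn (y i - z) < eps,
    sqn (y (f i) - z') = sqn (y i - z) + (sqn (y (f i)) - sqn (y i))
    & forall j, J j -> ip z' (y (f j)) = e i * e j * ip z (y j)].
Proof.
move=> fK fJ ee inv Ji eps0.
have [z [s hs zE] zi] := yx Ji eps0.
pose z' := e i *: \sum_(p <- s) (p.1 * e p.2) *: x (f p.2).
have z'y j : J j -> ip z' (y (f j)) = e i * e j * ip z (y j).
  move=> Jj; rewrite zE ipZl !ip_suml -mulrA !mulr_sumr.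
  apply: eq_big_seq => p /hs Jp; rewrite !ipZl !xy//; try exact: fJ.
  rewrite (inj_eq (can_inj fK)); have [->|_] := eqVneq p.2 j; first by ring.
  by rewrite !mulr0.
have z'z' : sqn z' = sqn z.
  rewrite ipZl ipZr mulrA -expr2 ee mul1r zE !ip_suml.
  apply: eq_big_seq => p /hs Jp; rewrite !ip_sumr.
  apply: eq_big_seq => q /hs Jq; rewrite !ipZl !ipZr -(inv _ _ Jp Jq); ring.
exists z, z'; split=> //.
by rewrite !sqnB (ipC (y (f i))) (ipC (y i)) z'y// z'z' -expr2 ee mul1r; ring.
Qed.

(** The distance in [transport_approx] being nonnegative, the norm of y i is
    at most that of y (f i); the inverse permutation gives equality.  Then z'
    is as close to y (f i) as z is to y i, and the inner products with y (f j)
    and y j agree in the limit. *)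
Lemma gram_invariance (f g : I -> I) (e : I -> R) :
  cancel f g -> cancel g f -> (forall k, J (f k) <-> J k) ->
  (forall k, e k ^+ 2 = 1) ->
  (forall k l, J k -> J l ->
     e k * e l * ip (x (f k)) (x (f l)) = ip (x k) (x l)) ->
  forall i j, J i -> J j ->
     e i * e j * ip (y (f i)) (y (f j)) = ip (y i) (y j).
Proof.
move=> fK gK fJ ee inv.
have fJ' k : J k -> J (f k) by move/fJ.
have gJ k : J k -> J (g k) by move=> Jk; apply/fJ; rewrite gK.
have le1 i : J i -> sqn (y i) <= sqn (y (f i)).
  move=> Ji; apply/ler_addgt0Pr => eps eps0.
  have [z [z' [h1 h2 _]]] := transport_approx fK fJ' ee inv Ji eps0.
  by have := ip_ge0 (y (f i) - z'); lra.
have le2 i : J i -> sqn (y (f i)) <= sqn (y i).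
  move=> Ji; apply/ler_addgt0Pr => eps eps0.
  have ee' k : e (g k) ^+ 2 = 1 by [].
  have inv' k l : J k -> J l ->
      e (g k) * e (g l) * ip (x (g k)) (x (g l)) = ip (x k) (x l).
    move=> Jk Jl; rewrite -inv; [|exact: gJ|exact: gJ].
    rewrite !gK -[RHS]mul1r -[X in _ = X * _]mul1r.
    by rewrite -{1}(ee (g k)) -(ee (g l)); ring.
  have [z [z' [h1 h2 _]]] := transport_approx gK gJ ee' inv' (fJ' _ Ji) eps0.
  by have := ip_ge0 (y (g (f i)) - z'); move: h2; rewrite fK; lra.
move=> i j Ji Jj; apply/eqP; rewrite -subr_eq0 -sqrf_eq0; apply/negPn/negP => h.
set D := _ - _ in h; have {}h : 0 < D ^+ 2 by rewrite lt_def h sqr_ge0.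
have y0 := ip_ge0 (y j); have y1 : 0 < 4 * (sqn (y j) + 1) by lra.
have [z [z' [h1 h2 h3]]] := transport_approx fK fJ' ee inv Ji (divr_gt0 h y1).
have hi : sqn (y (f i)) = sqn (y i) by apply/eqP; rewrite eq_le le1// le2.
have hj : sqn (y (f j)) = sqn (y j) by apply/eqP; rewrite eq_le le1// le2.
rewrite hi subrr addr0 in h2.
have DE : D = e i * e j * ip (y (f i) - z') (y (f j)) - ip (y i - z) (y j).
  rewrite /D !ipBl h3// mulrBr mulrA.
  have -> : e i * e j * (e i * e j) = e i ^+ 2 * e j ^+ 2 by ring.
  by rewrite !ee; ring.
have := cauchy_schwarz (y i - z) (y j).
have := cauchy_schwarz (y (f i) - z') (y (f j)); rewrite h2 hj.
move: h1 h; rewrite ltr_pdivlMr//.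
have : D ^+ 2 <= 2 * ip (y (f i) - z') (y (f j)) ^+ 2 + 2 * ip (y i - z) (y j) ^+ 2.
  rewrite DE; set a := ip _ _; set b := ip _ _.
  have := sqr_ge0 (e i * e j * a + b).
  have -> : 2 * a ^+ 2 = 2 * (e i * e j * a) ^+ 2.
    by rewrite !exprMn !ee !mul1r.
  by nra.
by have := ip_ge0 (y i - z); nra.
Qed.

End GramInvariance.

(** * Riesz bases and their dual bases *)

Section RieszBasis.
Context (I : eqType) (x : I -> E) (box : nat -> seq I) (m M : R).
Hypothesis box_uniq : forall n, uniq (box n).
Hypothesis box_ev : forall i, exists N, forall n, (N <= n)%N -> i \in box n.
Hypothesis m_gt0 : 0 < m.
Hypothesis M_ge0 : 0 <= M.
Hypothesis riesz_lower : forall (s : seq I) (c : I -> R), uniq s ->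
  m * \sum_(i <- s) c i ^+ 2 <= sqn (\sum_(i <- s) c i *: x i).
Hypothesis riesz_upper : forall (s : seq I) (c : I -> R), uniq s ->
  sqn (\sum_(i <- s) c i *: x i) <= M * \sum_(i <- s) c i ^+ 2.

Local Notation H := (ip_closure ip (lspan x setT)).

Let H_subspace : subspace H.
Proof. exact/ip_closure_subspace/lspan_subspace. Qed.

Lemma box_sub (s : seq I) :
  exists N, forall n, (N <= n)%N -> {subset s <= box n}.
Proof.
elim: s => [|i s [N hN]]; first by exists 0%N.
have [N' hN'] := box_ev i; exists (maxn N N') => n.
rewrite geq_max => /andP[/hN Nn /hN' N'n] j; rewrite inE => /predU1P[->//|].
exact: Nn.
Qed.

Section Innovation.
Context (n : I -> E).
Hypothesis nH : forall i, ip_closure ip (lspan x [set j | j != i]) (n i).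
Hypothesis n_orth : forall i z, ip_closure ip (lspan x [set j | j != i]) z ->
  ip (x i - n i) z = 0.

(** A vector x i - z with z a combination of the other x's has the coefficient
    1 on x i, so the lower Riesz bound applies to it. *)
Lemma innovation_ge i : m <= sqn (x i - n i).
Proof.
apply/ler_addgt0Pr => eps eps0.
have [z hz nz] := nH i eps0.
have zH : ip (x i - n i) (n i - z) = 0.
  rewrite ipBr !n_orth ?subrr//; exact: sub_ip_closure.
have [s [c [us si zE]]] := lspan_uniq hz.
have iNs : i \notin s by apply/negP => /si /=; rewrite eqxx.
have uis : uniq (i :: s) by rewrite /= iNs.
have := riesz_lower (fun j => if j == i then 1 else - c j) uis.
rewrite !big_cons eqxx scale1r expr1n.
have -> : \sum_(j <- s) (if j == i then 1 else - c j) *: x j = - z.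
  rewrite zE -sumrN; apply: eq_big_seq => j /si/= /negPf->.
  by rewrite scaleNr.
have -> : x i - z = (x i - n i) + (n i - z) by rewrite addrA subrK.
move: (x i - n i) (n i - z) nz zH => u v nz uv.
rewrite !(ipDl, ipDr) (ipC v) uv.
have : 0 <= \sum_(j <- s) (if j == i then 1 else - c j) ^+ 2.
  by apply: sumr_ge0 => j _; apply: sqr_ge0.
move: (\sum_(j <- s) _) => S S0.
by have := mulr_ge0 (ltW m_gt0) S0; lra.
Qed.

Lemma innovation_gt0 i : 0 < sqn (x i - n i).
Proof. exact: lt_le_trans (innovation_ge i). Qed.

(** n i stands for the projection of x i onto the closed span of the other
    vectors. *)
Definition dual_basis i := (sqn (x i - n i))^-1 *: (x i - n i).

Lemma dual_biorth i j : ip (dual_basis i) (x j) = (i == j)%:R.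
Proof.
rewrite /dual_basis ipZl; have [<-|ij] := eqVneq i j.
  have -> : ip (x i - n i) (x i) = sqn (x i - n i).
    by rewrite [RHS]ipBr (n_orth (nH i)) subr0.
  by rewrite mulVf// gt_eqF// innovation_gt0.
have jH : ip_closure ip (lspan x [set k | k != i]) (x j).
  by apply: sub_ip_closure; apply: mem_lspan; rewrite /= eq_sym.
by rewrite (n_orth jH) mulr0.
Qed.

Lemma dual_mem i : H (dual_basis i).
Proof.
rewrite /dual_basis; apply: (subspaceZ _ H_subspace); apply: (subspaceB H_subspace).
  by apply: sub_ip_closure; apply: mem_lspan.
apply: (ip_closureS _ (nH i)); apply: lspan_sub; first exact: lspan_subspace.
by move=> j _; apply: mem_lspan.
Qed.

Lemma sqn_dual i : ip (dual_basis i) (dual_basis i) = (sqn (x i - n i))^-1.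
Proof.
rewrite ipZl ipZr mulVf ?mulr1//; by rewrite gt_eqF// innovation_gt0.
Qed.

(** The off-diagonal entries of the Gram matrix of the dual basis are the
    rescaled coefficients of the predictors. *)
Lemma ip_dual_predictor i j : i != j ->
  ip (dual_basis i) (dual_basis j) = - (ip (n i) (dual_basis j) / sqn (x i - n i)).
Proof.
move=> ij; rewrite {1}/dual_basis ipZl [ip _ (dual_basis j)]ipBl (ipC (x i)) dual_biorth.
by rewrite eq_sym (negPf ij) sub0r mulrN mulrC.
Qed.

Lemma ip_predictor_dual i : ip (n i) (dual_basis i) = 0.
Proof. by rewrite ipC ipZl (n_orth (nH i)) mulr0. Qed.

End Innovation.

Section Dual.
Context (y : I -> E).
Hypothesis yx : forall i j, ip (y i) (x j) = (i == j)%:R.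

Lemma ip_sum_dual (s : seq I) (c : I -> R) j : uniq s -> j \in s ->
  ip (\sum_(i <- s) c i *: x i) (y j) = c j.
Proof.
move=> us js; rewrite ip_suml -[RHS](sum_eq1_seq c us js) [RHS]big_mkcond.
apply: eq_bigr => i _; rewrite ipZl ipC yx eq_sym.
by case: eqVneq => _; rewrite ?mulr1 ?mulr0.
Qed.

Lemma lspan_expansion w : lspan x setT w ->
  exists s0 : seq I, forall s, uniq s -> {subset s0 <= s} ->
    w = \sum_(i <- s) ip w (y i) *: x i.
Proof.
have hV : subspace [set w | exists s0 : seq I, forall s, uniq s -> {subset s0 <= s} ->
    w = \sum_(i <- s) ip w (y i) *: x i].
  split.
    by exists [::] => s _ _; rewrite big1// => i _; rewrite ip0l scale0r.
  move=> a u v /= [s1 h1] [s2 h2]; exists (s1 ++ s2) => s us hs.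
  have sub1 : {subset s1 <= s} by move=> i h; apply: hs; rewrite mem_cat h.
  have sub2 : {subset s2 <= s} by move=> i h; apply: hs; rewrite mem_cat h orbT.
  rewrite {1}(h1 _ us sub1) {1}(h2 _ us sub2).
  rewrite scaler_sumr -big_split; apply: eq_bigr => i _.
  by rewrite ipDl ipZl scalerDl scalerA.
apply: (lspan_sub hV) => j _; exists [:: j] => s us hs.
have js : j \in s by apply: hs; rewrite inE.
rewrite -[LHS](sum_eq1_seq x us js) big_mkcond; apply: eq_bigr => i _.
by rewrite ipC yx; case: eqVneq => _; rewrite ?scale1r ?scale0r.
Qed.

Lemma bessel_lspan w s : lspan x setT w -> uniq s ->
  m * \sum_(i <- s) ip w (y i) ^+ 2 <= sqn w.
Proof.
move=> /lspan_expansion[s0 hs0] us.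
have u' := undup_uniq (s ++ s0).
have sub0 : {subset s0 <= undup (s ++ s0)}.
  by move=> i h; rewrite mem_undup mem_cat h orbT.
rewrite [X in sqn X](hs0 _ u' sub0).
apply: le_trans (riesz_lower _ u'); rewrite ler_pM2l//.
rewrite (@sum_sub_seq _ _ s _ _ us u') => [|i si]; last first.
  by rewrite mem_undup mem_cat si.
rewrite [leRHS](bigID (mem s))/= lerDl sumr_ge0// => i _; exact: sqr_ge0.
Qed.

(** The factor 4, instead of 1, allows the crude bound
    (a + b)^2 <= 2 a^2 + 2 b^2 in the passage to the closure. *)
Lemma bessel z s : H z -> uniq s ->
  m * \sum_(i <- s) ip z (y i) ^+ 2 <= 4 * sqn z.
Proof.
move=> hz us; apply/ler_addgt0Pr => eps eps0.
pose K := 4 + 2 * m * \sum_(i <- s) sqn (y i).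
have S0 : 0 <= \sum_(i <- s) sqn (y i) by apply: sumr_ge0 => i _; exact: ip_ge0.
have K0 : 0 < K by have := mulr_ge0 (ltW m_gt0) S0; rewrite /K; lra.
have [w hw] := hz _ (divr_gt0 eps0 K0).
rewrite ltr_pdivlMr// => zw.
have h1 : \sum_(i <- s) ip z (y i) ^+ 2 <=
    2 * \sum_(i <- s) ip w (y i) ^+ 2 + 2 * (sqn (z - w) * \sum_(i <- s) sqn (y i)).
  rewrite !mulr_sumr -big_split/=; apply: ler_sum => i _.
  have := cauchy_schwarz (z - w) (y i); rewrite ipBl.
  by move: (ip z _) (ip w _) => a b; have := sqr_ge0 (a - 2 * b); lra.
have h2 := bessel_lspan hw us.
have h3 := sqnD_le z (w - z); rewrite subrKC (sqnBC w) in h3.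
move: h1; rewrite -(ler_pM2l m_gt0) => h1.
by rewrite /K in zw; nra.
Qed.

(** The partial sums are bounded operators, uniformly in n, by the upper Riesz
    bound and Bessel's inequality; and they are eventually exact on finite
    combinations, which are dense. *)
Lemma expansion z : H z ->
  ip_cvg ip (fun n => \sum_(i <- box n) ip z (y i) *: x i) z.
Proof.
move=> hz e e0.
pose K := 2 + 8 * (M / m).
have K0 : 0 < K by rewrite /K; have := divr_ge0 M_ge0 (ltW m_gt0); lra.
have [w hw] := hz _ (divr_gt0 e0 K0); rewrite ltr_pdivlMr// => zw.
have [s0 hs0] := lspan_expansion hw.
have [N hN] := box_sub s0; exists N => n Nn.
have wE := hs0 _ (box_uniq n) (hN _ Nn).
have zwH : H (z - w).
  by apply: (subspaceB H_subspace) => //; apply: sub_ip_closure.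
set S := \sum_(i <- _) _.
have -> : z - S = (z - w) - \sum_(i <- box n) ip (z - w) (y i) *: x i.
  rewrite -[RHS]addrA -opprD {1}wE -big_split/= -/S; congr (_ - _).
  by apply: eq_bigr => i _; rewrite -scalerDl ipBl subrKC.
apply: le_lt_trans (sqnD_le _ _) _.
have h1 := riesz_upper (fun i => ip (z - w) (y i)) (box_uniq n).
have h2 := bessel zwH (box_uniq n).
rewrite ipNl ipC ipNl opprK.
apply: le_lt_trans zw.
rewrite /K.
set B := \sum_(i <- box n) ip _ _ ^+ 2 in h1 h2.
have h3 : M * B <= 4 * (M / m) * sqn (z - w).
  have := ler_wpM2l (divr_ge0 M_ge0 (ltW m_gt0)) h2.
  by rewrite /= [M / m * (m * B)]mulrA divfK ?gt_eqF//; lra.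
by lra.
Qed.

(** This is where a Riesz basis is used rather than just a family with a
    biorthogonal one: the vanishing of the coefficients of z on J confines z to
    the closed span of the remaining vectors. *)
Lemma mem_ip_closure_setC J z : H z -> (forall i, J i -> ip z (y i) = 0) ->
  ip_closure ip (lspan x (~` J)) z.
Proof.
move=> hz zJ e e0; have [N hN] := expansion hz e0.
exists (\sum_(i <- box N) ip z (y i) *: x i); last exact: hN.
rewrite big_seq; elim/big_ind: _ => [|u v|i _].
- by case: (lspan_subspace x (~` J)).
- by apply: subspaceD; apply: lspan_subspace.
have [Ji|nJi] := pselect (J i).
  by rewrite zJ// scale0r; case: (lspan_subspace x (~` J)).
by apply: subspaceZ; [exact: lspan_subspace|exact: mem_lspan].
Qed.

(** * Residuals with respect to a subfamily *)

Section Residuals.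
Hypothesis yH : forall i, H (y i).
Hypothesis Ecomplete : ip_complete ip.
Context (J : set I) (q : I -> E).
Local Notation HJ := (ip_closure ip (lspan x (~` J))).
Hypothesis qH : forall i, J i -> HJ (q i).
Hypothesis q_orth : forall i z, J i -> HJ z -> ip (x i - q i) z = 0.

Let r i := x i - q i.

(** Hence the dual vectors of index in J live in the same space as the
    residuals. *)
Lemma dual_orth j z : J j -> HJ z -> ip (y j) z = 0.
Proof.
move=> Jj; apply: lspan_orth => i nJi; rewrite yx.
by case: eqVneq => // ji; exfalso; apply: nJi; rewrite -ji.
Qed.

Lemma residual_dual_biorth i j : J i -> J j -> ip (r i) (y j) = (i == j)%:R.
Proof.
move=> Ji Jj; rewrite /r ipC ipBr yx dual_orth ?subr0 1?eq_sym//.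
exact: qH.
Qed.

Let HJ_subspace : subspace HJ.
Proof. exact/ip_closure_subspace/lspan_subspace. Qed.

(** Replacing each x i by its residual r i (by 0 when i is outside J) projects
    a combination orthogonally onto the complement of HJ; y j is already there,
    so an approximation of y j only gets better. *)
Lemma dual_mem_residuals j : J j -> ip_closure ip (lspan r J) (y j).
Proof.
move=> Jj e e0; have [z hz yz] := yH j e0.
have [r' hr' [w hw zE]] : exists2 r', lspan r J r' & exists2 w, HJ w & z = r' + w.
  have hV : subspace [set z | exists2 r', lspan r J r' &
      exists2 w, HJ w & z = r' + w].
    split.
      exists 0; first by case: (lspan_subspace r J).
      by exists 0; [case: HJ_subspace | rewrite addr0].
    move=> a _ _ [r1 h1 [w1 g1 ->]] [r2 h2 [w2 g2 ->]].
    exists (a *: r1 + r2); first by case: (lspan_subspace r J) => _; apply.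
    exists (a *: w1 + w2); first by case: HJ_subspace => _; apply.
    by rewrite scalerDr addrACA.
  apply: (lspan_sub hV) hz => i _ /=.
  have [Ji|nJi] := pselect (J i).
    exists (r i); first exact: mem_lspan.
    by exists (q i); [exact: qH | rewrite subrK].
  exists 0; first by case: (lspan_subspace r J).
  by exists (x i); [apply: sub_ip_closure; apply: mem_lspan | rewrite add0r].
exists r' => //; apply: le_lt_trans yz.
have orth : ip (y j - r') w = 0.
  rewrite ipBl dual_orth// sub0r; apply/eqP; rewrite oppr_eq0; apply/eqP.
  rewrite ipC; apply: (@lspan_orth _ r J) (sub_ip_closure hr') => i Ji.
  by rewrite ipC; apply: q_orth.
by rewrite zE opprD addrA [leRHS]sqnB orth mulr0 subr0 lerDl ip_ge0.
Qed.

(** Let v be the projection of r j onto the closed span of the y i, i in J.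
    Then r j - v has no coefficient on J, so it lies in HJ; being also
    orthogonal to HJ, it has norm 0. *)
Lemma residual_mem_duals j : J j -> ip_closure ip (lspan y J) (r j).
Proof.
move=> Jj.
have [v [hv v_orth]] := orth_proj_exists (r j) Ecomplete (lspan_subspace y J).
have HJ_H : HJ `<=` H.
  apply: ip_closureS; apply: lspan_sub; first exact: lspan_subspace.
  by move=> i _; apply: mem_lspan.
have vH : H v.
  apply: ip_closure_idem; apply: (ip_closureS _ hv); apply: lspan_sub => //.
have rH : H (r j).
  by apply: (subspaceB H_subspace); [apply: sub_ip_closure; apply: mem_lspan|apply/HJ_H/qH].
have zHJ : HJ (r j - v).
  apply: mem_ip_closure_setC; first exact: (subspaceB H_subspace).
  by move=> i Ji; apply: v_orth; apply: sub_ip_closure; apply: mem_lspan.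
have : sqn (r j - v) = 0.
  rewrite ipBl q_orth// sub0r; apply/eqP; rewrite oppr_eq0; apply/eqP.
  rewrite ipC; apply: (lspan_orth _ hv) => i Ji.
  by rewrite ipC; apply: dual_orth.
by move=> z0; apply: ip_closure_idem => e e0; exists v => //; rewrite z0.
Qed.

(** One direction of [gram_invariance] for each of the two families. *)
Theorem gram_residual_dual_invariance (f g : I -> I) (e : I -> R) :
  cancel f g -> cancel g f -> (forall k, J (f k) <-> J k) ->
  (forall k, e k ^+ 2 = 1) ->
  (forall k l, J k -> J l ->
     e k * e l * ip (y (f k)) (y (f l)) = ip (y k) (y l)) <->
  (forall k l, J k -> J l ->
     e k * e l * ip (r (f k)) (r (f l)) = ip (r k) (r l)).
Proof.
move=> fK gK fJ ee; split.
  apply: (gram_invariance _ _ fK gK fJ ee) => [i j Ji Jj|i Ji].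
    by rewrite ipC residual_dual_biorth// eq_sym.
  exact: residual_mem_duals.
apply: (gram_invariance _ _ fK gK fJ ee) => [i j Ji Jj|i Ji].
  by rewrite residual_dual_biorth.
exact: dual_mem_residuals.
Qed.

End Residuals.
End Dual.
End RieszBasis.

End SemiInner.

(** * Completeness of square-integrable functions *)

Section RieszFischer.
Context (d : measure_display) (T : measurableType d) (R : realType).
Context (P : probability T R).

(** The hypothesis is in the extended reals because it comes from an
    integrable series, finite almost everywhere. *)
Lemma cvgn_of_summable_increments (v : nat -> R) :
  (\sum_(k <oo) (`|v k.+1 - v k|)%:E < +oo)%E -> cvgn v.
Proof.
move=> h.
have tel : cvgn (series (telescope v)).
  apply: normed_cvg; apply: nondecreasing_is_cvgn.
    by apply: nondecreasing_series => n _ _; exact: normr_ge0.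
  exists (fine (\sum_(k <oo) (`|v k.+1 - v k|)%:E)%E) => _ [n _ <-].
  rewrite -lee_fin fineK; last first.
    by rewrite ge0_fin_numE//; apply: nneseries_ge0 => k _ _; rewrite lee_fin.
  rewrite /series/= -sumEFin.
  by apply: (@nneseries_lim_ge R (fun k => (`|v k.+1 - v k|)%:E) xpredT 0%N n).
have -> : v = (fun n => v 0%N + series (telescope v) n).
  by apply/funext => n; rewrite -eq_sum_telescope.
by apply: is_cvgD => //; exact: is_cvg_cst.
Qed.

Lemma Lfun2P (f : T -> R) : f \in Lfun P 2%:E <->
  measurable_fun setT f /\ (\int[P]_x ((f x ^+ 2)%:E) < +oo)%E.
Proof.
have nE : (\int[P]_x ((f x ^+ 2)%:E) = \int[P]_x (`|f x| `^ 2)%:E)%E.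
  by apply: eq_integral => x _; rewrite powR_mulrn// real_normK ?num_real.
split.
  move=> hf; split.
    by move: hf; rewrite inE => /andP[/[!inE]/= mf _].
  have /integrableP[_] := Lfun2_integrable_sqr hf.
  apply: le_lt_trans; rewrite le_eqVlt; apply/orP; left; apply/eqP.
  by apply: eq_integral => x _ /=; rewrite ger0_norm ?sqr_ge0.
move=> [mf fi]; rewrite inE; apply/andP; split; rewrite inE//=.
rewrite /finite_norm unlock /Lnorm; apply: poweR_lty.
by move: fi; rewrite nE.
Qed.

(** Fatou's lemma: the mean square distance to f is lower semicontinuous under
    convergence almost everywhere. *)
Lemma fatou_sqr_dist (v : nat -> T -> R) (l f : T -> R) (e : R) :
  (forall k, measurable_fun setT (v k)) -> measurable_fun setT l ->
  measurable_fun setT f ->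
  {ae P, forall x, v ^~ x @ \oo --> l x} ->
  (\forall k \near \oo, (\int[P]_x (((v k x - f x) ^+ 2)%:E) <= e%:E)%E) ->
  (\int[P]_x (((l x - f x) ^+ 2)%:E) <= e%:E)%E.
Proof.
move=> mv ml mf vl he.
pose h (k : nat) : T -> \bar R := fun x => (((v k x - f x) ^+ 2)%:E).
have mh k : measurable_fun setT (h k).
  by apply/measurable_EFinP; apply: measurable_funX; apply: measurable_funB.
rewrite (@ge0_ae_eq_integral _ _ _ P setT _ (fun x => limn_einf (h ^~ x)))//.
- apply: le_trans (fatou P measurableT mh _) _.
    by move=> n x _; rewrite lee_fin sqr_ge0.
  rewrite limn_einf_lim; apply: lime_le; first exact: is_cvg_einfs.
  apply: filterS he => k; apply: le_trans; apply: ereal_inf_lbound.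
  by exists k => /=.
- by apply/measurable_EFinP; apply: measurable_funX; apply: measurable_funB.
- apply: (emeasurable_fun_cvg (fun n x => einfs (h ^~ x) n)) => [n|x _].
    exact: measurable_fun_einfs.
  by rewrite limn_einf_lim; exact: is_cvg_einfs.
- by move=> x _; rewrite lee_fin sqr_ge0.
- move=> x _; rewrite limn_einf_lim; apply: lime_ge; first exact: is_cvg_einfs.
  apply: nearW => k; apply: le_ereal_inf_tmp => _ [n _ <-].
  by rewrite lee_fin sqr_ge0.
- apply: filterS vl => x vlx _; apply/esym; apply: (cvg_limn_einf_sup _).1.
  by apply: cvg_EFin; [exact: nearW|rewrite expr2; apply: cvgM; apply: cvgB => //; exact: cvg_cst].
Qed.

(** Riesz-Fischer.  Along a subsequence v with mean square increments at most
    w k ^+ 2, where w k = 2^-(k+1), the inequality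
    t <= w + t^2 / w bounds the increments by a series of integral at most 2.
    So v converges almost everywhere, and by Fatou's lemma its limit is also
    the limit in mean square. *)
Lemma L2_complete (u : nat -> T -> R) :
  (forall n, u n \in Lfun P 2%:E) ->
  (forall e : R, 0 < e -> exists N, forall m n, (N <= m)%N -> (N <= n)%N ->
     (\int[P]_x (((u m x - u n x) ^+ 2)%:E) <= e%:E)%E) ->
  exists2 l, l \in Lfun P 2%:E &
    forall e : R, 0 < e -> exists N, forall n, (N <= n)%N ->
     (\int[P]_x (((l x - u n x) ^+ 2)%:E) <= e%:E)%E.
Proof.
move=> uL uC.
have mu n : measurable_fun setT (u n) by have /Lfun2P[] := uL n.
have [w [w0 wE]] : exists w : nat -> R, (forall k, 0 < w k) /\
    forall k, w k + w k = 2 / (2 ^ k.+1)%:R.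
  exists (fun k => (2 ^ k.+1)%:R^-1); split=> k; last by ring.
  by rewrite invr_gt0 ltr0n expn_gt0.
have [N hN] := choice (fun k => uC (w k ^+ 2) (exprn_gt0 2 (w0 k))).
pose nk k := (\sum_(j < k.+1) N j + k)%N.
have nk_ge n k : (n <= k)%N -> (N n <= nk k)%N.
  by move=> nk_k; rewrite /nk (bigD1 (Ordinal (nk_k : (n < k.+1)%N)))//= -!addnA leq_addr.
pose v k := u (nk k).
pose g (k : nat) : T -> \bar R :=
  fun x => (w k + (w k)^-1 * (v k.+1 x - v k x) ^+ 2)%:E.
have g0 k x : (0 <= g k x)%E.
  rewrite lee_fin; apply: addr_ge0; first exact: ltW.
  by apply: mulr_ge0; [rewrite invr_ge0 ltW|exact: sqr_ge0].
have mg k : measurable_fun setT (g k).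
  apply/measurable_EFinP; apply: measurable_funD => //.
  by apply: measurable_funM => //; apply: measurable_funX; apply: measurable_funB; exact: mu.
have ig k : (\int[P]_x g k x <= (2 / (2 ^ k.+1)%:R)%:E)%E.
  under eq_integral do rewrite /g EFinD EFinM.
  rewrite ge0_integralD//; last 3 first.
  - by move=> x _; rewrite lee_fin ltW.
  - by move=> x _; rewrite lee_fin mulr_ge0 ?invr_ge0 ?sqr_ge0// ltW.
  - apply/measurable_EFinP; apply: measurable_funM => //.
    by apply: measurable_funX; apply: measurable_funB; exact: mu.
  rewrite integral_cst//= probability_setT mule1 ge0_integralZl_EFin//; last 3 first.
  - by move=> x _; rewrite lee_fin sqr_ge0.
  - apply/measurable_EFinP; apply: measurable_funX; apply: measurable_funB; exact: mu.
  - by rewrite invr_ge0 ltW.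
  rewrite (_ : (2 / _)%:E = (w k)%:E + ((w k)^-1)%:E * ((w k) ^+ 2)%:E)%E.
    rewrite leeD2l// lee_pmul2l ?lte_fin ?invr_gt0//.
    by apply: hN; apply: nk_ge.
  by rewrite -EFinM -EFinD expr2 mulKf ?gt_eqF// wE.
have mG : measurable_fun setT (fun x => \sum_(k <oo) g k x)%E.
  by apply: ge0_emeasurable_sum.
have gi : P.-integrable setT (fun x => \sum_(k <oo) g k x)%E.
  apply/integrableP; split => //.
  under eq_integral do rewrite gee0_abs ?nneseries_ge0//.
  rewrite integral_nneseries//.
  apply: (@le_lt_trans _ _ (\sum_(k <oo) (2 / (2 ^ k.+1)%:R)%:E)%E).
    apply: lee_nneseries => [k _ _|k _]; last exact: ig.
    by apply: integral_ge0 => x _; exact: g0.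
  by apply: le_lt_trans (epsilon_trick0 xpredT _) (ltry _).
have vl : {ae P, forall x, cvgn (v ^~ x)}.
  apply: filterS (integrable_ae measurableT gi) => x /(_ Logic.I) gx.
  apply: cvgn_of_summable_increments.
  apply: (@le_lt_trans _ _ (\sum_(k <oo) g k x)%E); last first.
    by rewrite -ge0_fin_numE// nneseries_ge0.
  apply: lee_nneseries => // k _; rewrite lee_fin.
  set D := v k.+1 x - v k x.
  have := sqr_ge0 (w k - `|D|); rewrite sqrrB real_normK ?num_real// => h.
  rewrite -(ler_pM2l (w0 k)) mulrDr mulrA mulfV ?gt_eqF// mul1r.
  by have := mulr_ge0 (ltW (w0 k)) (normr_ge0 D); lra.
(* An upper limit is defined and measurable even where v diverges. *)
pose l x := fine (limn_esup (fun k => (v k x)%:E)).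
have ml : measurable_fun setT l.
  apply: (measurableT_comp (fine_measurable measurableT)).
  by apply: measurable_fun_limn_esup => k; apply/measurable_EFinP; exact: mu.
have {}vl : {ae P, forall x, v ^~ x @ \oo --> l x}.
  apply: filterS vl => x vx; rewrite /l.
  have vxE : (v k x)%:E @[k --> \oo] --> (limn (v ^~ x))%:E.
    by apply: cvg_EFin => //; exact: nearW.
  by rewrite (cvg_limn_einf_sup vxE).2.
have lu e : 0 < e -> exists N0, forall n, (N0 <= n)%N ->
     (\int[P]_x (((l x - u n x) ^+ 2)%:E) <= e%:E)%E.
  move=> e0; have [N0 hN0] := uC e e0; exists N0 => n N0n.
  apply: (fatou_sqr_dist _ ml _ vl) => [k||]; [exact: mu|exact: mu|].
  apply: filterS (nbhs_infty_ge N0) => k N0k; apply: hN0 => //.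
  exact: leq_trans N0k (leq_addl _ _).
exists l => //.
have [n0 /(_ n0 (leqnn n0)) h0] := lu 1 ltr01.
have -> : l = ((l \- u n0) : T -> R) + u n0.
  by apply/funext => x; rewrite [RHS]subrK.
have one_le2 : (1 <= 2%:E :> \bar R)%E by rewrite lee_fin ler1n.
apply: (Lfun_addr_closed P one_le2).2 => //.
apply/Lfun2P; split; last exact: le_lt_trans h0 (ltry _).
by apply: measurable_funB => //; exact: mu.
Qed.

End RieszFischer.

(** * The covariance as a complete semi-inner product *)

Section CovarianceSpace.
Context (d : measure_display) (T : measurableType d) (R : realType).
Context (P : probability T R).

Lemma one_le2 : (1 <= 2%:E :> \bar R)%E.
Proof. by rewrite lee_fin ler1n. Qed.

Definition L2space := LfunType P one_le2.
(** The covariance is degenerate on constants as well as on null functions, so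
    that centring a variable does not move it. *)
Definition L2cov (x y : L2space) := cov P x y.

Lemma L2P (x : L2space) : (x : T -> R) \in Lfun P 2%:E.
Proof. exact: LfunP. Qed.

Let L21 (f : T -> R) : f \in Lfun P 2%:E -> f \in Lfun P 1.
Proof. by apply: Lfun_subset12; rewrite fin_num_measure. Qed.

Lemma cov_fin (f g : T -> R) : f \in Lfun P 2%:E -> g \in Lfun P 2%:E ->
  covariance P f g \is a fin_num.
Proof.
by move=> hf hg; apply: covariance_fin_num; [exact: L21|exact: L21|exact: Lfun2_mul_Lfun1].
Qed.

Lemma covE (f : T -> R) : f \in Lfun P 2%:E ->
  (cov P f f)%:E = (\int[P]_x ((f x ^+ 2)%:E) - 'E_P[f] * 'E_P[f])%E.
Proof.
move=> hf; rewrite fineK ?cov_fin// covarianceE; [|exact: L21|exact: L21|].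
  by congr (_ - _)%E; rewrite unlock; apply: eq_integral => x _; rewrite /= expr2.
exact: Lfun2_mul_Lfun1.
Qed.

Lemma cov_semi_inner : semi_inner L2cov.
Proof.
split.
- by move=> x y; rewrite /L2cov /cov covarianceC.
- move=> a x y z; rewrite /L2cov /cov.
  have -> : (a *: x + y : L2space) = ((a \o* x) \+ y)%R :> (T -> R).
    by apply/funext => w /=; rewrite mulrC.
  have ax : (a \o* x)%R \in Lfun P 2%:E by apply: Lfun_scale; [rewrite ler1n|exact: L2P].
  rewrite covarianceDl ?L2P// fineD ?cov_fin ?L2P//.
  rewrite covarianceZl ?fineM ?cov_fin ?L2P//; try (by apply: L21; exact: L2P).
  by apply: Lfun2_mul_Lfun1; exact: L2P.
- by move=> x; apply: fine_ge0; apply: variance_ge0.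
Qed.

Lemma expectationE (f : T -> R) : ('E_P[f] = \int[P]_x (f x)%:E)%E.
Proof. by rewrite unlock. Qed.

Lemma variance_integral (f : T -> R) :
  (covariance P f f = \int[P]_x (((f x - fine 'E_P[f]) ^+ 2)%:E))%E.
Proof.
rewrite covariance.unlock expectationE; apply: eq_integral => x _.
by rewrite /= expr2.
Qed.

(** The centred sequence is a Cauchy sequence in mean square, and centring its
    limit can only decrease the distances. *)
Lemma cov_complete : ip_complete L2cov.
Proof.
move=> u uC.
pose m n := fine ('E_P[u n])%E.
pose v n : T -> R := fun x => u n x - m n.
have covB (f g : L2space) : (cov P (f - g) (f - g))%:E =
    (\int[P]_x (((f x - fine ('E_P[f]) - (g x - fine ('E_P[g]))) ^+ 2)%:E))%E.
  rewrite /cov fineK ?cov_fin ?(L2P (f - g))// variance_integral.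
  apply: eq_integral => x _.
  rewrite (_ : ((f - g : L2space) : T -> R) = f \- g)//.
  rewrite expectationB ?L21 ?L2P// fineB ?expectation_fin_num ?L21 ?L2P//.
  by congr ((_ ^+ 2)%:E); rewrite /=; ring.
have vL n : v n \in Lfun P 2%:E.
  have -> : v n = (u n : T -> R) + cst (- m n) by [].
  by apply: (Lfun_addr_closed P one_le2).2; [exact: L2P|exact: Lfun_cst].
have vC e : 0 < e -> exists N, forall a b, (N <= a)%N -> (N <= b)%N ->
     (\int[P]_x (((v a x - v b x) ^+ 2)%:E) <= e%:E)%E.
  move=> e0; have [N hN] := uC e e0; exists N => a b Na Nb.
  by rewrite -covB lee_fin ltW// hN.
have [l lL hl] := L2_complete vL vC.
pose l' : L2space := Lfun_Sub one_le2 lL.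
exists l' => e e0; have [N hN] := hl (e / 2) ltac:(lra).
exists N => n Nn; apply: (@le_lt_trans _ _ (e / 2)); last lra.
rewrite -lee_fin; apply: le_trans (hN n Nn).
rewrite covB.
have gL : (fun x => l x - v n x) \in Lfun P 2%:E.
  rewrite (_ : (fun x => _) = l + (- v n : T -> R))//.
  apply: (Lfun_addr_closed P one_le2).2 => //.
  exact: (Lfun_oppr_closed (vL n)).
have Ev : ('E_P[v n] = 0)%E.
  rewrite (_ : v n = (u n : T -> R) \- cst (m n))//.
  rewrite expectationB ?L21 ?L2P ?Lfun_cst// expectation_cst.
  by rewrite /m fineK ?subee ?expectation_fin_num ?L21 ?L2P.
have Eg : fine ('E_P[(fun x => l x - v n x)%R])%E = fine ('E_P[l])%E.
  by rewrite (_ : (fun x => _) = l \- v n)// expectationB ?L21// Ev sube0.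
have := covE gL.
rewrite /cov fineK ?cov_fin// variance_integral Eg => h.
apply: (@le_trans _ _ (\int[P]_x ((l x - v n x - fine ('E_P[l])%E) ^+ 2)%:E)%E).
  rewrite le_eqVlt; apply/orP; left; apply/eqP; apply: eq_integral => x _.
  by congr ((_ ^+ 2)%:E); rewrite /v /m /l' /=; ring.
rewrite h leeBlDr ?fin_numM ?expectation_fin_num ?L21// leeDl//.
by rewrite -(fineK (expectation_fin_num (L21 gL))) -EFinM lee_fin -expr2 sqr_ge0.
Qed.
End CovarianceSpace.
Arguments one_le2 {R}.

(** * The numerical range on finitely supported sequences *)

(** The index set of the n-th partial sum of a series indexed by the integers. *)
Definition zrange (n : nat) : seq int :=
  [seq Posz k | k <- iota 0 n] ++ [seq Negz k | k <- iota 0 n].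

Lemma zrange_uniq n : uniq (zrange n).
Proof.
rewrite cat_uniq !map_inj_uniq ?iota_uniq//=; last 2 first.
- by move=> i j [].
- by move=> i j [].
by rewrite andbT; apply/hasPn => _ /mapP[k _ ->]; apply/negP => /mapP[].
Qed.

Lemma mem_zrange n t : (t \in zrange n) = match t with Posz k | Negz k => (k < n)%N end.
Proof.
rewrite mem_cat; case: t => k.
- rewrite mem_map ?mem_iota ?add0n/=; last by move=> i j [].
  by rewrite (_ : _ \in _ = false) ?orbF//; apply/negP => /mapP[].
- rewrite orbC mem_map ?mem_iota ?add0n/=; last by move=> i j [].
  by rewrite (_ : _ \in _ = false) ?orbF//; apply/negP => /mapP[].
Qed.

Lemma zpartialE (V : nmodType) (f : int -> V) n :
  zpartial f n = \sum_(t <- zrange n) f t.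
Proof.
rewrite /zpartial big_split/= big_cat/= !big_map.
by rewrite (_ : iota 0 n = index_iota 0 n) ?big_mkord// /index_iota subn0.
Qed.

Lemma zpartial_stable (V : nmodType) (f : int -> V) N n :
  (forall t, t \notin zrange N -> f t = 0) -> (N <= n)%N ->
  zpartial f n = zpartial f N.
Proof.
move=> f0 Nn; rewrite /zpartial -!(big_mkord xpredT (fun k => f (Posz k) + f (Negz k))).
have tail : \sum_(N <= k < n) (f (Posz k) + f (Negz k)) = 0.
  rewrite big_nat_cond big1// => k; rewrite andbT => /andP[Nk _].
  by rewrite !f0 ?addr0// mem_zrange -leqNgt.
by rewrite (@big_cat_nat _ _ _ N)//= tail addr0.
Qed.

Lemma zsum_finite (K : numFieldType) (f : int -> K) N :
  (forall t, t \notin zrange N -> f t = 0) -> zsum f = \sum_(t <- zrange N) f t.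
Proof.
move=> f0; rewrite -zpartialE; apply: norm_lim_near_cst.
by apply: filterS (nbhs_infty_ge N) => n Nn; apply: zpartial_stable.
Qed.

Lemma ell2_finite (K : numFieldType) (u : int -> K) N :
  (forall t, t \notin zrange N -> u t = 0) -> ell2 u.
Proof.
move=> u0; apply: (is_cvg_near_cst (zpartial (fun t => `|u t| ^+ 2) N)).
apply: filterS (nbhs_infty_ge N) => n; apply: zpartial_stable => t tN.
by rewrite u0// normr0 expr0n.
Qed.

Section Box.
Context (p : nat).

Definition box (n : nat) : seq (int * 'I_p) :=
  [seq (t, b) | t <- zrange n, b <- enum 'I_p].

Lemma mem_box n i : (i \in box n) = (i.1 \in zrange n).
Proof.
apply/allpairsP/idP => [[[t b] /= [tn _ ->]]//|].
by case: i => t b tn; exists (t, b); rewrite mem_enum.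
Qed.

Lemma box_uniq n : uniq (box n).
Proof.
apply: allpairs_uniq; rewrite ?zrange_uniq ?enum_uniq//.
by move=> [? ?] [? ?].
Qed.

Lemma box_ev i : exists N, forall n, (N <= n)%N -> i \in box n.
Proof.
exists (match i.1 with Posz k | Negz k => k.+1 end) => n.
by rewrite mem_box mem_zrange; case: i => [[k|k] b].
Qed.

Lemma sum_box (V : nmodType) n (F : int -> 'I_p -> V) :
  \sum_(i <- box n) F i.1 i.2 = \sum_(t <- zrange n) \sum_(b < p) F t b.
Proof.
by rewrite big_allpairs; apply: eq_bigr => t _; rewrite big_enum.
Qed.

End Box.

Section QuadraticForm.
Context (R : realType) (p : nat) (A : 'I_p -> 'I_p -> int -> int -> R).
Implicit Types (c : int * 'I_p -> R) (n : nat).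

Definition quad n c : R :=
  \sum_(i <- box p n) \sum_(j <- box p n) c i * A i.2 j.2 i.1 j.1 * c j.

Definition finite_vector n c : 'I_p -> int -> R[i] :=
  fun s t => if t \in zrange n then ((c (t, s))%:C)%C else 0.

Let finite_vector0 n c s t : t \notin zrange n -> finite_vector n c s t = 0.
Proof. by rewrite /finite_vector => /negPf->. Qed.

Let conj_real (x : R) : ((x%:C)%C)^* = (x%:C)%C.
Proof. exact: conjc_real. Qed.

Lemma finite_vector_ell2p n c : ell2p (finite_vector n c).
Proof.
move=> s.
apply: (@ell2_finite _ _ n) => t; exact: finite_vector0.
Qed.

Lemma dotp_finite_vector n c : dotp (finite_vector n c) (finite_vector n c) =
  ((\sum_(i <- box p n) c i ^+ 2)%:C)%C.
Proof.
rewrite /dotp (eq_bigr (fun s => \sum_(t <- zrange n) ((c (t, s) ^+ 2)%:C)%C)).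
  rewrite exchange_big/= -(sum_box n (fun t s => ((c (t, s) ^+ 2)%:C)%C)).
  by rewrite rmorph_sum; apply: eq_bigr => -[].
move=> s _; rewrite (@zsum_finite _ _ n) => [|t tn]; last by rewrite finite_vector0// mulr0.
apply: eq_big_seq => t tn.
by rewrite /finite_vector tn conj_real -rmorphM expr2.
Qed.

Lemma dotp_block_mul n c :
  dotp (finite_vector n c) (block_mul A (finite_vector n c)) = ((quad n c)%:C)%C.
Proof.
have Av a t : block_mul A (finite_vector n c) a t =
    ((\sum_(j <- box p n) A a j.2 t j.1 * c j)%:C)%C.
  rewrite /block_mul (eq_bigr (fun b => \sum_(u <- zrange n)
      ((A a b t u * c (u, b))%:C)%C)).
    rewrite exchange_big/= -(sum_box n (fun u b => ((A a b t u * c (u, b))%:C)%C)).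
    by rewrite rmorph_sum; apply: eq_bigr => -[].
  move=> b _; rewrite (@zsum_finite _ _ n) => [|u un]; last by rewrite finite_vector0// mulr0.
  by apply: eq_big_seq => u un; rewrite /finite_vector un -rmorphM.
rewrite /dotp (eq_bigr (fun s => \sum_(t <- zrange n)
    ((c (t, s) * \sum_(j <- box p n) A s j.2 t j.1 * c j)%:C)%C)).
  rewrite exchange_big/= -(sum_box n (fun t s =>
    ((c (t, s) * \sum_(j <- box p n) A s j.2 t j.1 * c j)%:C)%C)).
  rewrite /quad rmorph_sum; apply: eq_bigr => -[t s] _; congr (_%:C)%C.
  by rewrite mulr_sumr; apply: eq_bigr => j _; rewrite mulrA.
move=> s _; rewrite (@zsum_finite _ _ n) => [|t tn].
  by apply: eq_big_seq => t tn; rewrite Av /finite_vector tn conj_real -rmorphM.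
by rewrite finite_vector0// conjC0 mul0r.
Qed.

Lemma quad_num_range n c : \sum_(i <- box p n) c i ^+ 2 = 1 ->
  num_range A (quad n c)%:E.
Proof.
move=> c1; exists (finite_vector n c); last by rewrite dotp_block_mul.
by split; [exact: finite_vector_ell2p | rewrite dotp_finite_vector c1].
Qed.

Lemma quad0 n c : \sum_(i <- box p n) c i ^+ 2 = 0 -> quad n c = 0.
Proof.
move=> c0; rewrite /quad big_seq big1// => i ib; rewrite big1// => j _.
suff -> : c i = 0 by rewrite !mul0r.
apply/eqP; rewrite -sqrf_eq0; apply/eqP.
move/eqP: c0; rewrite psumr_eq0; last by move=> k _; exact: sqr_ge0.
by move=> /allP/(_ _ ib)/eqP.
Qed.

Lemma quad_normalize n c : let Q := \sum_(i <- box p n) c i ^+ 2 in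
  0 < Q -> num_range A (quad n c / Q)%:E.
Proof.
move=> Q Q0; pose c' i := c i / Num.sqrt Q.
have s2 : (Num.sqrt Q)^-1 * (Num.sqrt Q)^-1 = Q^-1.
  by rewrite -invfM -expr2 sqr_sqrtr// ltW.
have -> : quad n c / Q = quad n c'.
  rewrite /quad mulr_suml; apply: eq_bigr => i _.
  rewrite mulr_suml; apply: eq_bigr => j _.
  by rewrite -s2 /c'; ring.
apply: quad_num_range; under eq_bigr do rewrite /c' exprMn.
by rewrite -mulr_suml expr2 s2 mulfV// gt_eqF.
Qed.

Lemma quad_lower n c (m : R) : (m%:E <= lambda_inf A)%E ->
  m * \sum_(i <- box p n) c i ^+ 2 <= quad n c.
Proof.
move=> hm; set Q := \sum_(i <- _) _.
have : 0 <= Q by apply: sumr_ge0 => i _; exact: sqr_ge0.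
rewrite le_eqVlt => /predU1P[Q0|Q0].
  by rewrite -Q0 mulr0 quad0.
have := le_trans hm (ereal_inf_lbound (quad_normalize Q0)).
by rewrite lee_fin ler_pdivlMr.
Qed.

Lemma quad_upper n c (M : R) : (lambda_sup A <= M%:E)%E ->
  quad n c <= M * \sum_(i <- box p n) c i ^+ 2.
Proof.
move=> hM; set Q := \sum_(i <- _) _.
have : 0 <= Q by apply: sumr_ge0 => i _; exact: sqr_ge0.
rewrite le_eqVlt => /predU1P[Q0|Q0].
  by rewrite -Q0 mulr0 quad0.
have := le_trans (ereal_sup_ubound (quad_normalize Q0)) hM.
by rewrite lee_fin ler_pdivrMr.
Qed.

End QuadraticForm.

(** * Toeplitz blocks and signed permutations of the index set *)

Section ToeplitzLag.
Context (R : Type) (A : int -> int -> R).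

Lemma toeplitzP : toeplitz A <-> forall h t u, A (t + h) (u + h) = A t u.
Proof.
split=> [[r rE] h t u|inv].
  by rewrite !rE; congr r; rewrite opprD addrACA subrr addr0.
by exists (fun k => A k 0) => t u; rewrite -(inv (- u)) subrr.
Qed.

Lemma toeplitz_lag : toeplitz A <-> forall t u, A t u = A 0 (u - t).
Proof.
split=> [/toeplitzP inv t u|lagE]; first by rewrite -(inv (- t)) subrr.
by exists (fun k => A 0 (- k)) => t u; rewrite opprB.
Qed.

(** On a diagonal block the sign of the lag is irrelevant by symmetry, which
    accounts for t - u here and u - t in [toeplitz_lag]. *)
Lemma toeplitz_lag_sym : (forall t u, A t u = A u t) ->
  toeplitz A <-> forall t u, A t u = A 0 (t - u).
Proof.
move=> symA; rewrite toeplitz_lag; split=> lagE t u.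
  by rewrite symA lagE.
by rewrite symA lagE.
Qed.

End ToeplitzLag.

Section Invariances.
Context (R : realType) (p : nat).
Local Notation I := (int * 'I_p)%type.

(** G is seen as a matrix indexed by the pairs (time, component): its block on S
    is fixed by conjugation by the monomial matrix of f and e. *)
Definition monomial_invariant (G : 'I_p -> 'I_p -> int -> int -> R) (S : {set 'I_p})
    (f : I -> I) (e : I -> R) : Prop :=
  forall k l : I, k.2 \in S -> l.2 \in S ->
    e k * e l * G (f k).2 (f l).2 (f k).1 (f l).1 = G k.2 l.2 k.1 l.1.

Definition time_shift (h : int) (k : I) : I := (k.1 + h, k.2).

Definition sign_flip (a : 'I_p) (k : I) : R := if k.2 == a then 1 else -1.

Context (G : 'I_p -> 'I_p -> int -> int -> R).
Hypothesis Gsym : forall a b t u, G a b t u = G b a u t.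

(** Only the blocks (a, b) and (b, a) change sign, so they must equal their
    opposites. *)
Lemma sign_flip_invariantP a b : a != b ->
  monomial_invariant G [set a; b]%SET id (sign_flip a) <-> forall t u, G a b t u = 0.
Proof.
move=> ab; split=> [inv t u|G0 [t c] [u e]].
  have := inv (t, a) (u, b); rewrite /= !inE !eqxx orbT /sign_flip/= eqxx.
  by rewrite eq_sym (negPf ab) => /(_ isT isT); lra.
rewrite /= !inE /sign_flip/= => /orP[] /eqP-> /orP[] /eqP->;
  rewrite ?eqxx ?(eq_sym b) ?(negPf ab) ?mulrNN ?mulr1 ?mul1r//.
- by rewrite G0 mulr0.
- by rewrite Gsym G0 mulr0.
Qed.

Lemma shift_invariantP S :
  (forall h, monomial_invariant G S (time_shift h) (fun=> 1)) <->
  forall a b, a \in S -> b \in S -> toeplitz (G a b).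
Proof.
split=> [inv a b aS bS|toep h [t c] [u e] /= cS eS].
  apply/toeplitzP => h t u.
  by have := inv h (t, a) (u, b) aS bS; rewrite /= !mul1r.
by rewrite !mul1r; have /toeplitzP -> := toep _ _ cS eS.
Qed.

Lemma toeplitz_tr a b : toeplitz (G a b) -> toeplitz (G b a).
Proof. by move=> [r rE]; exists (fun k => r (- k)) => t u; rewrite Gsym rE opprB. Qed.

Lemma shift_invariant1P a :
  (forall h, monomial_invariant G [set a]%SET (time_shift h) (fun=> 1)) <-> toeplitz (G a a).
Proof.
rewrite shift_invariantP; split=> [h|h b c].
  by apply: h; rewrite inE.
by rewrite !inE => /eqP-> /eqP->.
Qed.

Lemma shift_invariant2P a b :
  (forall h, monomial_invariant G [set a; b]%SET (time_shift h) (fun=> 1)) <->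
  [/\ toeplitz (G a a), toeplitz (G b b) & toeplitz (G a b)].
Proof.
rewrite shift_invariantP; split=> [h|[haa hbb hab] c e].
  by split; apply: h; rewrite !inE eqxx ?orbT.
rewrite !inE => /orP[] /eqP-> /orP[] /eqP-> //.
exact: toeplitz_tr.
Qed.

End Invariances.

(** * The dual series and the residuals *)

Section TimeSeries.
Context (d : measure_display) (T : measurableType d) (R : realType).
Context (P : probability T R) (p : nat) (X : int -> 'I_p -> {RV P >-> R}).
Hypothesis hmean : forall t a, ('E_P[X t a] = 0)%E.
Hypothesis hvar : forall t a, (X t a : T -> R) \in Lfun P 2%:E.

Local Notation I := (int * 'I_p)%type.
Local Notation ip := (@L2cov _ _ _ P).
Let ipP := cov_semi_inner P.

Definition Xvec (i : I) : L2space P := Lfun_Sub one_le2 (hvar i.1 i.2).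

Lemma L2_sumE (s : seq I) (c : I -> R) :
  ((\sum_(i <- s) c i *: Xvec i : L2space P) : T -> R) =
  (fun w => \sum_(i <- s) c i * X i.1 i.2 w).
Proof.
apply/funext => w; elim: s => [|i s IHs]; first by rewrite !big_nil.
by rewrite !big_cons -IHs.
Qed.

(** An element of L2space need not have mean zero, whereas the closed spans of
    the time series are made of centred variables. *)
Lemma centring (y : L2space P) :
  exists y' : L2space P, ('E_P[y'] = 0)%E /\ forall z, ip y' z = ip y z.
Proof.
have Y1 : (y : T -> R) \in Lfun P 1.
  by apply: Lfun_subset12; rewrite ?fin_num_measure ?L2P.
pose k : L2space P := Lfun_Sub one_le2 (Lfun_cst P (fine ('E_P[y])%E) 2).
exists (y - k); split.
  rewrite (_ : ((y - k : L2space P) : T -> R) = y \- cst (fine ('E_P[y])%E))//.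
  have Efin := expectation_fin_num Y1.
  by rewrite expectationB ?Lfun_cst// expectation_cst fineK// subee.
move=> z; rewrite (ipBl ipP).
have -> : ip k z = 0 by rewrite /L2cov /cov (covariance_cst_l P _ z).
by rewrite subr0.
Qed.

Lemma closed_linspanP (K : set I) (Y : T -> R) :
  closed_linspan X K Y <->
  exists y : L2space P, [/\ (y : T -> R) = Y, ('E_P[y] = 0)%E & ip_closure ip (lspan Xvec K) y].
Proof.
split=> [[[YL EY] h]|[y [<- Ey hy]]].
  exists (Lfun_Sub one_le2 YL); split=> // e e0.
  have [_ [s [c [sK ->]]] hZ] := h (Num.sqrt e) ltac:(by rewrite sqrtr_gt0).
  exists (\sum_(i <- s) c i *: Xvec i).
    apply: subspace_sum; first exact: lspan_subspace.
    by move=> i /sK; exact: mem_lspan.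
  by move: hZ; rewrite sqr_sqrtr ?ltW// -L2_sumE.
split; first by split; [exact: L2P|].
move=> e e0; have [z hz yz] := hy (e ^+ 2) (exprn_gt0 2 e0).
have [s [c [_ sK zE]]] := lspan_uniq hz.
exists z => //; exists s, c; split; first exact: sK.
by rewrite zE L2_sumE.
Qed.

(** The function picked by [proj] is determined up to almost sure equality only,
    but it satisfies the defining property of the projection. *)
Lemma proj_exists (K : set I) (v : L2space P) : exists q : L2space P,
  [/\ (q : T -> R) = Defs.proj P (closed_linspan X K) v, ('E_P[q] = 0)%E,
      ip_closure ip (lspan Xvec K) q
    & forall w, ip_closure ip (lspan Xvec K) w -> ip (v - q) w = 0].
Proof.
have closure_centring (y y' : L2space P) : (forall z, ip y' z = ip y z) ->
    ip_closure ip (lspan Xvec K) y -> ip_closure ip (lspan Xvec K) y'.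
  move=> yy' hy e e0; have [z hz yz] := hy e e0; exists z => //.
  have y'y' : ip y' y' = ip y y by rewrite yy' (ipC ipP) yy'.
  by move: yz; rewrite !(sqnB ipP) y'y' yy'.
have [q0 [q0K q0_orth]] := orth_proj_exists ipP v (cov_complete (P := P))
  (lspan_subspace Xvec K).
have [q1 [Eq1 q1E]] := centring q0.
have ex : exists Z, is_proj P (closed_linspan X K) v Z.
  exists q1; split.
    by apply/closed_linspanP; exists q1; split=> //; apply: closure_centring q0K.
  move=> _ /closed_linspanP[w [<- _ hw]].
  have := q0_orth _ hw; rewrite (ipBl ipP) -q1E -(ipBl ipP) => <-.
  by [].
have [/closed_linspanP[q [qE Eq qK]] horth] := xgetPex (cst 0) ex.
exists q; split=> // w hw; have [w' [Ew' w'E]] := centring w.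
have := horth w'; rewrite /= (ipC ipP) -w'E => <-; last first.
  by apply/closed_linspanP; exists w'; split=> //; apply: closure_centring hw.
by rewrite -qE (ipC ipP).
Qed.

Hypothesis hinf : (0 < lambda_inf (Cblock X))%E.
Hypothesis hsup : (lambda_sup (Cblock X) < +oo)%E.

Lemma quad_cov n (c : I -> R) : quad (Cblock X) n c =
  ip (\sum_(i <- box p n) c i *: Xvec i) (\sum_(i <- box p n) c i *: Xvec i).
Proof.
rewrite (ip_suml ipP); apply: eq_bigr => i _.
rewrite (ip_sumr ipP); apply: eq_bigr => j _.
rewrite (ipZl ipP) (ipZr ipP) /Cblock /Cmx mxE -mulrA; congr (_ * _).
by rewrite mulrC.
Qed.

Lemma extend_box (s : seq I) (c : I -> R) : uniq s ->
  exists n c', \sum_(i <- s) c i ^+ 2 = \sum_(i <- box p n) c' i ^+ 2 /\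
    \sum_(i <- s) c i *: Xvec i = \sum_(i <- box p n) c' i *: Xvec i.
Proof.
move=> us; have [N hN] := box_sub (@box_ev p) s.
exists N, (fun i => if i \in s then c i else 0).
have sN := hN _ (leqnn N); have bu := box_uniq p N.
split.
  rewrite (sum_sub_seq _ us bu sN) big_mkcond; apply: eq_bigr => i _.
  by case: ifP => // _; rewrite expr0n.
rewrite (sum_sub_seq _ us bu sN) big_mkcond; apply: eq_bigr => i _.
by case: ifP => // _; rewrite scale0r.
Qed.

(** The quadratic form of C at c is the variance of the combination with the
    coefficients c, so its bounds on unit vectors are Riesz bounds. *)
Lemma riesz_bounds : exists m M : R, [/\ 0 < m, 0 <= M,
  forall (s : seq I) (c : I -> R), uniq s -> m * \sum_(i <- s) c i ^+ 2 <=
    ip (\sum_(i <- s) c i *: Xvec i) (\sum_(i <- s) c i *: Xvec i)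
  & forall (s : seq I) (c : I -> R), uniq s ->
    ip (\sum_(i <- s) c i *: Xvec i) (\sum_(i <- s) c i *: Xvec i) <=
    M * \sum_(i <- s) c i ^+ 2].
Proof.
have [m m0 hm] : exists2 m : R, 0 < m & (m%:E <= lambda_inf (Cblock X))%E.
  move: hinf; case: (lambda_inf _) => [r||] // r0.
    by exists r.
  by exists 1; rewrite ?leey.
have [M M0 hM] : exists2 M : R, 0 <= M & (lambda_sup (Cblock X) <= M%:E)%E.
  move: hsup; case: (lambda_sup _) => [r||] // _.
    by exists (Num.max r 0); rewrite ?lee_fin le_max lexx ?orbT.
  by exists 0; rewrite ?leNye.
exists m, M; split=> // s c us; have [n [c' [-> ->]]] := extend_box c us;
  rewrite -quad_cov.
- exact: quad_lower.
- exact: quad_upper.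
Qed.

Lemma sigma2E (i : I) (n : L2space P) : (n : T -> R) = node_proj X i.1 i.2 ->
  ('E_P[n] = 0)%E -> sigma2 X i.2 i.1 = ip (Xvec i - n) (Xvec i - n).
Proof.
move=> nE En; rewrite /sigma2 /L2cov /cov -nE variance_integral.
rewrite (_ : ((Xvec i - n : L2space P) : T -> R) = (X i.1 i.2 : T -> R) \- n)//.
have L21 (y : L2space P) : (y : T -> R) \in Lfun P 1.
  by apply: Lfun_subset12; rewrite ?fin_num_measure ?L2P.
rewrite expectationB; [|exact: (L21 (Xvec i))|exact: L21].
rewrite En hmean subee// expectationE; congr fine; apply: eq_integral => w _.
by rewrite subr0.
Qed.

Lemma partial_sumE (be : int -> 'I_p -> R) n :
  zpartial (fun t => fun w : T => \sum_(b < p) be t b * X t b w) n =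
  (\sum_(i <- box p n) be i.1 i.2 *: Xvec i : L2space P) :> (T -> R).
Proof.
rewrite L2_sumE zpartialE; apply/funext => w.
rewrite (sum_box n (fun t b => be t b * X t b w)).
by elim: (zrange n) => [|t s IHs]; rewrite ?big_nil// !big_cons -IHs.
Qed.

Lemma is_coefP (i : I) (n : L2space P) (be : int -> 'I_p -> R) :
  (n : T -> R) = node_proj X i.1 i.2 ->
  is_coef X i.1 i.2 be <-> be i.1 i.2 = 0 /\
   ip_cvg ip (fun k => \sum_(j <- box p k) be j.1 j.2 *: Xvec j) n.
Proof.
move=> nE; rewrite /is_coef -nE.
have SE k : cov P ((n : T -> R) \- zpartial (fun t => fun w : T =>
      \sum_(b < p) be t b * X t b w) k) ((n : T -> R) \- zpartial (fun t =>
      fun w : T => \sum_(b < p) be t b * X t b w) k) =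
    ip (n - \sum_(j <- box p k) be j.1 j.2 *: Xvec j)
       (n - \sum_(j <- box p k) be j.1 j.2 *: Xvec j).
  by rewrite partial_sumE.
split=> -[be0 h]; split=> //.
  move=> e e0; move/cvgrPdist_lt: h => /(_ e e0)[N _ hN]; exists N => k Nk.
  by have := hN k Nk; rewrite /= SE sub0r normrN ger0_norm// (ip_ge0 ipP).
apply/cvgrPdist_lt => e e0; have [N hN] := h e e0.
apply: filterS (nbhs_infty_ge N) => k Nk.
by rewrite SE sub0r normrN ger0_norm ?hN// (ip_ge0 ipP).
Qed.

(** The predictors n i are the projections [node_proj]; the choice made by
    [beta] does not matter, since any admissible family of coefficients is
    recovered by taking inner products with the dual basis. *)
Lemma dual_series (m M : R) : 0 < m -> 0 <= M ->
  (forall (s : seq I) (c : I -> R), uniq s -> m * \sum_(i <- s) c i ^+ 2 <=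
    ip (\sum_(i <- s) c i *: Xvec i) (\sum_(i <- s) c i *: Xvec i)) ->
  (forall (s : seq I) (c : I -> R), uniq s ->
    ip (\sum_(i <- s) c i *: Xvec i) (\sum_(i <- s) c i *: Xvec i) <=
    M * \sum_(i <- s) c i ^+ 2) ->
  exists y : I -> L2space P, [/\ forall i j, ip (y i) (Xvec j) = (i == j)%:R,
    forall i, ip_closure ip (lspan Xvec setT) (y i)
    & forall i j, Dblock X i.2 j.2 i.1 j.1 = ip (y i) (y j)].
Proof.
move=> m0 M0 lower upper.
have [n hn] := choice (fun i : I => proj_exists [set j | j != i] (Xvec i)).
have nE i : (n i : T -> R) = node_proj X i.1 i.2.
  by have [-> _ _ _] := hn i; case: i.
have nH i : ip_closure ip (lspan Xvec [set j | j != i]) (n i) by have [] := hn i.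
have n_orth i z : ip_closure ip (lspan Xvec [set j | j != i]) z -> ip (Xvec i - n i) z = 0.
  by have [_ _ _] := hn i; apply.
pose y := dual_basis ip Xvec n.
have yx := dual_biorth ipP m0 lower nH n_orth.
have nFull i : ip_closure ip (lspan Xvec setT) (n i).
  apply: (ip_closureS _ (nH i)); apply: (lspan_sub (lspan_subspace Xvec setT)).
  by move=> j _; apply: mem_lspan.
have betaE i j : Defs.beta X j.1 j.2 i.1 i.2 = ip (n i) (y j).
  have ex : exists be, is_coef X i.1 i.2 be.
    exists (fun t b => ip (n i) (y (t, b))); apply/(is_coefP _ (nE i)).
    split; first by case: i; move=> t a; apply: (ip_predictor_dual ipP).
    have := expansion ipP (@box_uniq p) (@box_ev p) m0 M0 lower upper yx (nFull i).
    have -> : (fun k => \sum_(j <- box p k) ip (n i) (y j) *: Xvec j) =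
        (fun k => \sum_(j <- box p k) ip (n i) (y (j.1, j.2)) *: Xvec j) => //.
    by apply/funext => k; apply: eq_bigr => -[t b].
  have := xgetPex (fun _ _ => 0) ex.
  rewrite [be in is_coef _ _ _ be](_ : _ = fun t b => Defs.beta X t b i.1 i.2)//.
  move=> /(is_coefP _ (nE i))[_ conv].
  apply/esym/eqP; rewrite -subr_eq0 -sqrf_eq0; apply/negPn/negP => h.
  set D := _ - _ in h; have {}h : 0 < D ^+ 2 by rewrite lt_def h sqr_ge0.
  have y0 := ip_ge0 ipP (y j); have y1 : 0 < ip (y j) (y j) + 1 by lra.
  have [N1 hN1] := conv _ (divr_gt0 h y1); have [N2 hN2] := box_ev j.
  pose k := maxn N1 N2.
  move: hN1 hN2 => /(_ k (leq_maxl _ _)) + /(_ k (leq_maxr _ _)).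
  rewrite ltr_pdivlMr// => hk jk.
  have := cauchy_schwarz ipP (n i - \sum_(l <- box p k)
    Defs.beta X l.1 l.2 i.1 i.2 *: Xvec l) (y j).
  rewrite (ipBl ipP) (ip_sum_dual ipP yx (fun l => Defs.beta X l.1 l.2 i.1 i.2)
    (box_uniq p k) jk) -/D => hD.
  by move: hk; have := ip_ge0 ipP (n i - \sum_(l <- box p k)
    Defs.beta X l.1 l.2 i.1 i.2 *: Xvec l); nra.
have DE i j : Dblock X i.2 j.2 i.1 j.1 = ip (y i) (y j).
  have En : ('E_P[n i] = 0)%E by have [] := hn i.
  have -> : Dblock X i.2 j.2 i.1 j.1 = if i == j then (sigma2 X i.2 i.1)^-1
      else - Defs.beta X j.1 j.2 i.1 i.2 / sigma2 X i.2 i.1.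
    rewrite /Dblock (_ : ((_, _) == _) = (i == j))//.
    by case: i j {En} => [t a] [u b]; rewrite !xpair_eqE andbC.
  rewrite (sigma2E (nE i) En); have [<-|ij] := eqVneq i j.
    by rewrite (sqn_dual ipP m0 lower nH n_orth).
  by rewrite betaE (ip_dual_predictor ipP m0 lower nH n_orth ij) mulNr.
exists y; split=> //; exact: dual_mem.
Qed.

Theorem invariant_Dblock_rho (S : {set 'I_p}) (f g : I -> I) (e : I -> R) :
  cancel f g -> cancel g f -> (forall k, (f k).2 = k.2) ->
  (forall k, e k ^+ 2 = 1) ->
  monomial_invariant (Dblock X) S f e <-> monomial_invariant (rho X S) S f e.
Proof.
move=> fK gK f2 ee.
have [m [M [m0 M0 lower upper]]] := riesz_bounds.
have [y [yx yH DE]] := dual_series m0 M0 lower upper.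
have [q hq] := choice (fun i : I => proj_exists [set j | j.2 \notin S] (Xvec i)).
have rhoE i j : rho X S i.2 j.2 i.1 j.1 = ip (Xvec i - q i) (Xvec j - q j).
  have [qi _ _ _] := hq i; have [qj _ _ _] := hq j.
  by rewrite /rho /residual /L2cov -qi -qj.
pose J := [set i : I | i.2 \in S].
have JC : [set j : I | j.2 \notin S] = ~` J.
  by apply/seteqP; split=> j /= /negP.
have qH i : J i -> ip_closure ip (lspan Xvec (~` J)) (q i).
  by rewrite -JC; have [] := hq i.
have q_orth i z : J i -> ip_closure ip (lspan Xvec (~` J)) z -> ip (Xvec i - q i) z = 0.
  by rewrite -JC; have [_ _ _ h] := hq i => _; exact: h.
have fJ k : J (f k) <-> J k by rewrite /J /= f2.
have := gram_residual_dual_invariance ipP (@box_uniq p) (@box_ev p) m0 M0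
  lower upper yx yH (cov_complete (P := P)) qH q_orth fK gK fJ ee.
rewrite /monomial_invariant => h; split=> inv k l kS lS.
  rewrite !rhoE; apply: h.1 => // k' l' kS' lS'.
  by rewrite -!DE; apply: inv.
rewrite !DE; apply: h.2 => // k' l' kS' lS'.
by rewrite -!rhoE; apply: inv.
Qed.

Lemma Dblock_sym a b t u : Dblock X a b t u = Dblock X b a u t.
Proof.
have [m [M [m0 M0 lower upper]]] := riesz_bounds.
have [y [_ _ DE]] := dual_series m0 M0 lower upper.
by rewrite (DE (t, a) (u, b)) (DE (u, b) (t, a)) (ipC ipP).
Qed.

Lemma rho_sym S a b t u : rho X S a b t u = rho X S b a u t.
Proof. by rewrite /rho /cov covarianceC. Qed.

End TimeSeries.

(** * Partial covariances and the inverse covariance *)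

Theorem theorem2p2 (d : measure_display) (T : measurableType d) (R : realType)
    (P : probability T R) (p : nat) (X : int -> 'I_p -> {RV P >-> R})
    (hp : (1 <= p)%N)
    (hmean : forall t a, ('E_P[X t a] = 0)%E)
    (hvar : forall t a, (X t a : T -> R) \in Lfun P 2%:E)
    (hC : (ereal_sup (range (fun t : int => (mx_norm (Cmx X t t))%:E)) < +oo)%E)
    (hinf : (0 < lambda_inf (Cblock X))%E)
    (hle : (lambda_inf (Cblock X) <= lambda_sup (Cblock X))%E)
    (hsup : (lambda_sup (Cblock X) < +oo)%E) :
  (forall a b : 'I_p, a != b ->
     (Dblock X a b = (fun _ _ => 0) <->
      forall t tau : int, rho X [set a; b]%SET a b t tau = 0)) /\
  (forall a : 'I_p,
     toeplitz (Dblock X a a) <->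
     forall t tau : int,
       rho X [set a]%SET a a t tau = rho X [set a]%SET a a 0 (t - tau)) /\
  (forall a b : 'I_p, a != b ->
     ([/\ toeplitz (Dblock X a a), toeplitz (Dblock X b b)
        & toeplitz (Dblock X a b)] <->
      forall t tau : int,
        [/\ rho X [set a; b]%SET a a t tau = rho X [set a; b]%SET a a 0 (t - tau),
            rho X [set a; b]%SET b b t tau = rho X [set a; b]%SET b b 0 (t - tau)
          & rho X [set a; b]%SET a b t tau =
            rho X [set a; b]%SET a b 0 (tau - t)])).
Proof.
have Dsym := Dblock_sym hmean hvar hinf hsup.
have inv := invariant_Dblock_rho hmean hvar hinf hsup.
have shiftK h : cancel (time_shift h) (@time_shift p (- h)).
  by case=> t a; rewrite /time_shift /= addrK.
have shiftNK h : cancel (@time_shift p (- h)) (time_shift h).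
  by case=> t a; rewrite /time_shift /= subrK.
have shift_inv S h : monomial_invariant (Dblock X) S (time_shift h) (fun=> 1) <->
    monomial_invariant (rho X S) S (time_shift h) (fun=> 1).
  by apply: inv (shiftK h) (shiftNK h) _ _ => // k; rewrite expr1n.
have shifts_inv S : (forall h, monomial_invariant (Dblock X) S (time_shift h) (fun=> 1)) <->
    (forall h, monomial_invariant (rho X S) S (time_shift h) (fun=> 1)).
  by split=> hS h; apply/shift_inv.
split=> [a b ab|]; [|split=> [a|a b ab]].
- have flip1 k : sign_flip R a k ^+ 2 = 1.
    by rewrite /sign_flip; case: ifP; rewrite ?sqrrN expr1n.
  rewrite -(sign_flip_invariantP (rho_sym X _) ab) -inv// (sign_flip_invariantP Dsym ab).
  split=> [-> //|D0]; apply/funext => t; apply/funext => u; exact: D0.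
- rewrite -(shift_invariant1P (Dblock X)) shifts_inv shift_invariant1P.
  exact: (toeplitz_lag_sym (rho_sym X _ a a)).
- rewrite -(shift_invariant2P Dsym) shifts_inv (shift_invariant2P (rho_sym X _)).
  have aaP := toeplitz_lag_sym (rho_sym X [set a; b]%SET a a).
  have bbP := toeplitz_lag_sym (rho_sym X [set a; b]%SET b b).
  have abP := toeplitz_lag (rho X [set a; b]%SET a b).
  split=> [[/aaP haa /bbP hbb /abP hab] t u|h]; first by split.
  by split; [apply/aaP|apply/bbP|apply/abP] => t u; have [] := h t u.
Qed.
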